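(* Let $n\in\mathbb{N}$, $\alpha\in(0,1)$ and $p\in\left(\frac{1}{1-\alpha},+\infty\right]$. If $f\in BV^{\alpha,p}(\mathbb{R}^n)$, $\varphi\in\operatorname{Lip}_c(\mathbb{R}^n;\mathbb{R}^n)$ and $x\in\mathbb{R}^n$, then $$\int_{B_r(x)}f\,\operatorname{div}^\alpha\varphi\,dy+\int_{\mathbb{R}^n}f\,\varphi\cdot\nabla^\alpha\chi_{B_r(x)}\,dy+\int_{\mathbb{R}^n}f\,\operatorname{div}^\alpha_{\rm NL}(\chi_{B_r(x)},\varphi)\,dy=-\int_{B_r(x)}\varphi\cdot dD^\alpha f$$ for $\mathcal{L}^1$-a.e. $r>0$.
   Context: $\operatorname{Lip}_c$ denotes Lipschitz maps with compact support; $B_r(x)$ is the open ball, $\chi_E$ the indicator of $E$. Let $\mu_{n,\alpha}=2^{\alpha}\pi^{-n/2}\Gamma\left(\frac{n+\alpha+1}{2}\right)/\Gamma\left(\frac{1-\alpha}{2}\right)$. Define $\operatorname{div}^\alpha\varphi(x)=\mu_{n,\alpha}\int\frac{(y-x)\cdot(\varphi(y)-\varphi(x))}{|y-x|^{n+\alpha+1}}dy$, $\nabla^\alpha g(x)=\mu_{n,\alpha}\int\frac{(y-x)(g(y)-g(x))}{|y-x|^{n+\alpha+1}}dy$, and $\operatorname{div}^\alpha_{\rm NL}(g,\varphi)(x)=\mu_{n,\alpha}\int_{\mathbb{R}^n}\frac{(g(y)-g(x))\,(y-x)\cdot(\varphi(y)-\varphi(x))}{|y-x|^{n+\alpha+1}}\,dy$,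 whenever the integrals converge. For $p\in[1,+\infty]$, $BV^{\alpha,p}(\mathbb{R}^n)$ is the set of $f\in L^p(\mathbb{R}^n)$ with $|D^\alpha f|(\mathbb{R}^n):=\sup\{\int f\operatorname{div}^\alpha\varphi\,dx:\varphi\in C^\infty_c(\mathbb{R}^n;\mathbb{R}^n),\ \|\varphi\|_{L^\infty}\le1\}<+\infty$; for such $f$, $D^\alpha f$ is the unique finite $\mathbb{R}^n$-valued Radon measure with $\int f\operatorname{div}^\alpha\varphi\,dx=-\int\varphi\cdot dD^\alpha f$ for all $\varphi\in C^\infty_c(\mathbb{R}^n;\mathbb{R}^n)$. *)

(* Defs.v *)
From HB Require Import structures.
From mathcomp Require Import all_boot all_order all_algebra.
From mathcomp Require Import all_classical all_reals all_analysis.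
Set Implicit Arguments. Unset Strict Implicit. Unset Printing Implicit Defensive.
Import Order.TTheory GRing.Theory Num.Theory.
Import numFieldNormedType.Exports.
Local Open Scope classical_set_scope.
Local Open Scope ring_scope.

Section Defs.
Variables (R : realType) (n : nat).

(* R^n is represented by row vectors 'rV[R]_n, with the Euclidean structure
   defined explicitly below (the library norm on matrices is the sup norm). *)
Definition dotv (u v : 'rV[R]_n) : R := \sum_(i < n) u ord0 i * v ord0 i.
Definition enorm (u : 'rV[R]_n) : R := Num.sqrt (dotv u u).

Definition eball (x : 'rV[R]_n) (r : R) : set 'rV[R]_n :=
  [set y | enorm (y - x) < r].

Definition Rn : measurableType (sigma_display (@open 'rV[R]_n)) :=
  g_sigma_algebraType (@open 'rV[R]_n).

(* lam is (the Borel restriction of) the n-dimensional Lebesgue measure: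
   it gives half-open boxes their volume.  This determines lam uniquely. *)
Definition is_lebesgue_Rn (lam : {measure set Rn -> \bar R}) : Prop :=
  forall a b : 'rV[R]_n, (forall i, a ord0 i <= b ord0 i) ->
    lam [set y : Rn | forall i, a ord0 i <= y ord0 i < b ord0 i]
    = (\prod_(i < n) (b ord0 i - a ord0 i))%:E.

Definition Gamma (s : R) : R :=
  Rintegral (@lebesgue_measure R) `]0%R, +oo[%classic
    (fun t => t `^ (s - 1) * expR (- t)).

Definition mu_na (alpha : R) : R :=
  2 `^ alpha * pi `^ (- (n%:R / 2)) * Gamma ((n%:R + alpha + 1) / 2)
  / Gamma ((1 - alpha) / 2).

Definition kern (alpha : R) (x y : 'rV[R]_n) : R :=
  (enorm (y - x) `^ (n%:R + alpha + 1))^-1.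

Variable lam : {measure set Rn -> \bar R}.

Definition fdiv (alpha : R) (phi : 'rV[R]_n -> 'rV[R]_n) (x : 'rV[R]_n) : R :=
  mu_na alpha * Rintegral lam [set: Rn]
    (fun y => dotv (y - x) (phi y - phi x) * kern alpha x y).

Definition fgrad (alpha : R) (g : 'rV[R]_n -> R) (x : 'rV[R]_n) : 'rV[R]_n :=
  \row_(i < n) (mu_na alpha * Rintegral lam [set: Rn]
    (fun y => (y - x) ord0 i * (g y - g x) * kern alpha x y)).

Definition fdivNL (alpha : R) (g : 'rV[R]_n -> R) (phi : 'rV[R]_n -> 'rV[R]_n)
    (x : 'rV[R]_n) : R :=
  mu_na alpha * Rintegral lam [set: Rn]
    (fun y => (g y - g x) * dotv (y - x) (phi y - phi x) * kern alpha x y).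

End Defs.

Section Regularity.
Variables (R : realType) (n : nat).

Fixpoint iter_dir (f : 'rV[R]_n -> R) (s : seq 'rV[R]_n) : 'rV[R]_n -> R :=
  match s with
  | [::] => f
  | v :: s' => fun a => derive (iter_dir f s') a v
  end.

Definition smooth (f : 'rV[R]_n -> R) : Prop :=
  forall s : seq 'rV[R]_n, continuous (iter_dir f s) /\
    (forall (a v : 'rV[R]_n), derivable (iter_dir f s) a v).

Definition compact_support (phi : 'rV[R]_n -> 'rV[R]_n) : Prop :=
  compact (closure [set x | phi x != 0]).

Definition Ccinf (phi : 'rV[R]_n -> 'rV[R]_n) : Prop :=
  (forall i : 'I_n, smooth (fun x => phi x ord0 i)) /\ compact_support phi.

Definition Lipc (phi : 'rV[R]_n -> 'rV[R]_n) : Prop :=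
  (exists L : R, forall x y, enorm (phi x - phi y) <= L * enorm (x - y))
  /\ compact_support phi.

Definition BV_ap (lam : {measure set Rn R n -> \bar R}) (alpha : R) (p : \bar R)
    (f : 'rV[R]_n -> R) : Prop :=
  [/\ measurable_fun [set: Rn R n] (f : Rn R n -> R),
      (Lnorm lam p (EFin \o (f : Rn R n -> R)) < +oo)%E &
      exists M : R, forall phi, Ccinf phi -> (forall x, enorm (phi x) <= 1) ->
        Rintegral lam [set: Rn R n] (fun x => f x * fdiv lam alpha phi x) <= M].

(* integral of g against the finite signed measure mup - mun *)
Definition charge_integral (mup mun : {finite_measure set Rn R n -> \bar R})
    (D : set (Rn R n)) (g : 'rV[R]_n -> R) : R :=
  Rintegral mup D g - Rintegral mun D g.

(* (mup i - mun i)_i is the fractional variation D^alpha f: for every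
   phi in C_c^infinity, int f div^alpha phi = - int phi . dD^alpha f *)
Definition is_Dalpha (lam : {measure set Rn R n -> \bar R}) (alpha : R)
    (f : 'rV[R]_n -> R) (mup mun : 'I_n -> {finite_measure set Rn R n -> \bar R}) :
    Prop :=
  forall phi, Ccinf phi ->
    Rintegral lam [set: Rn R n] (fun x => f x * fdiv lam alpha phi x)
    = - \sum_(i < n) charge_integral (mup i) (mun i) [set: Rn R n]
                               (fun x => phi x ord0 i).

End Regularity.

(* Main.v *)
Require Import Defs.
From HB Require Import structures.
From mathcomp Require Import all_boot all_order all_algebra.
From mathcomp Require Import all_classical all_reals all_analysis.
From mathcomp Require Import measurable_realfun ess_sup_inf.
From mathcomp Require Import ring lra.
Set Implicit Arguments. Unset Strict Implicit. Unset Printing Implicit Defensive.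
Import Order.TTheory GRing.Theory Num.Theory.
Import numFieldNormedType.Exports.
Local Open Scope classical_set_scope.
Local Open Scope ring_scope.

(** Write q_i(y,z) = (z - y)_i |z - y|^(-n-alpha-1).  By Fubini the duality
    formula for D^alpha f against a field g e_i says that the linear functional

      defect_i(g) = mu * int int f(y) q_i(y,z) (g(z) - g(y)) dz dy
                    + int g d(D^alpha f)_i

    vanishes at g.  It commutes with superpositions g = int psi_s dnu(s) as soon
    as int |psi_s(z) - psi_s(y)| dnu(s) <= C min(1,|z - y|), because
    min(1,|z - y|) |z - y|^(-n-alpha) is integrable in z uniformly in y and
    |f| <= 1 + |f|^p.
    This is used twice.  Superposing translates of a smooth bump gives
    defect_i = 0 on mollified Lipschitz functions, hence on all compactly
    supported Lipschitz functions by dominated convergence.  Next, for a bounded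
    Borel set A of radii, int_A 1_{B_s(x)} phi_i ds is Lipschitz with compact
    support, so int_A defect_i(1_{B_s(x)} phi_i) ds = 0; as A is arbitrary,
    defect_i(1_{B_s(x)} phi_i) = 0 for a.e. s.  The identity
      c(z) phi(z) - c(y) phi(y) = c(y) (phi(z) - phi(y)) + (c(z) - c(y)) phi(y)
                                  + (c(z) - c(y)) (phi(z) - phi(y))
    with c = 1_{B_s(x)} then splits the double integral into the three terms of
    the statement. *)

(** * Fubini for real-valued integrals *)

(** The indicator of a ball is not Lipschitz, so at a fixed radius no estimate dominates the double
    integral of [f] against the increments of [1_{B_s(x)} phi_i]. Averaging over radii supplies one:
    the radii separating [y] from [z] lie in an interval of length at most [n |z - y|]. Fubini then
    returns absolute convergence at almost every radius, one of the two sources of the exceptional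
    null set. Convergence has to accompany every identity, because [Rintegral] is 0 by default when
    the extended integral is infinite, and an integral may be split into three only under
    integrability. The increment bounds also carry a weight [1_S(y) + 1_S(z)], with [S] a cube
    containing the support. Since [f] is merely in L^p, the majorant integrated in [z] must be
    bounded in [y] (to pair with [|f|^p]) and integrable in [y] (to pair with 1). The uniform kernel
    bound gives the first; the second follows from the finite measure of [S] and the symmetry of the
    kernel. *)

Lemma ae_eq_integrable d (T : measurableType d) (R : realType)
    (mu : {measure set T -> \bar R}) (D : set T) (f g : T -> \bar R) :
  measurable D -> measurable_fun D g -> ae_eq mu D f g ->
  mu.-integrable D f -> mu.-integrable D g.
Proof.
move=> mD mg fg /integrableP[mf fi]; apply/integrableP; split => //.
suff <- : (\int[mu]_(x in D) `|f x| = \int[mu]_(x in D) `|g x|)%E by [].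
apply: ae_eq_integral => //; [exact: measurableT_comp..|].
by apply: filterS fg => x fgx Dx /=; rewrite fgx.
Qed.

(** The theorem takes [lam] as a bare measure, whereas product measures and Fubini use the bundled
    sigma-finite structure; the equality lets the bundled measure be substituted for [lam]. *)
Lemma ex_sigma_finite_measure d (T : measurableType d) (R : realType)
    (mu : {measure set T -> \bar R}) : sigma_finite [set: T] mu ->
  exists nu : {sigma_finite_measure set T -> \bar R},
    (nu : {measure set T -> \bar R}) = mu.
Proof.
move=> H; pose H2 := isSFinite.Build _ _ _ _ (sfinite_measure_sigma_finite H).
pose H3 := isSigmaFinite.Build _ _ _ _ H.
pose nu := HB.pack_for (SigmaFiniteMeasure.type T R) (Measure.sort mu) H2 H3.
by exists nu; exact: eq_measure.
Qed.

Section RFubini.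
Context d1 d2 (T1 : measurableType d1) (T2 : measurableType d2) (R : realType).
Variable m1 : {sigma_finite_measure set T1 -> \bar R}.
Variable m2 : {sigma_finite_measure set T2 -> \bar R}.

(** Needed to use [lam \x lam] as one factor of a further product, when superpositions are
    integrated over [Y * (E * E)]. The rectangles of exhausting sets are enumerated through
    [pickle], with the empty set at indices that code no pair. *)
Lemma product_sigma_finite : sigma_finite [set: T1 * T2] (m1 \x m2)%E.
Proof.
have [F FT Fm] := sigma_finiteT m1; have [G GT Gm] := sigma_finiteT m2.
have mX k l : measurable (F k `*` G l).
  by apply: measurableX; [exact: (Fm k).1|exact: (Gm l).1].
exists (fun k => if unpickle k is Some kl then F kl.1 `*` G kl.2 else set0).
  apply/seteqP; split => // -[x y] _.
  have [k _ Fx] : (\bigcup_k F k) x by rewrite -FT.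
  have [l _ Gy] : (\bigcup_k G k) y by rewrite -GT.
  by exists (pickle (k, l)) => //; rewrite pickleK.
move=> k; case: (unpickle k) => [[i j]|]; last by rewrite measure0.
split; first exact: mX.
have [mF Fi] := Fm i; have [mG Gj] := Gm j.
by rewrite product_measure1E// lte_mul_pinfty// ge0_fin_numE.
Qed.

Definition product_sf : {sigma_finite_measure set (T1 * T2)%type -> \bar R} :=
  HB.pack (m1 \x m2)%E
    (@Measure_isSigmaFinite.Build _ _ _ (m1 \x m2)%E product_sigma_finite).

(** No integrability is required: Tonelli makes the integrals of the positive and negative parts
    measurable, and so are their difference and its image under [fine]. *)
Lemma measurable_Rintegral_section (F : T1 * T2 -> R) :
  measurable_fun [set: T1 * T2] F ->
  measurable_fun [set: T1] (fun x => Rintegral m2 [set: T2] (fun y => F (x, y))).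
Proof.
move=> mF.
have mF' : measurable_fun setT (EFin \o F) by exact/measurable_EFinP.
rewrite [X in measurable_fun _ X](_ : _ = fine \o (fun x =>
    (\int[m2]_y (EFin \o F)^\+ (x, y) - \int[m2]_y (EFin \o F)^\- (x, y))%E)).
  apply: (measurableT_comp (fine_measurable measurableT)).
  by apply: emeasurable_funB; apply: measurable_fun_fubini_tonelli_F => //;
    [exact: measurable_funepos|exact: measurable_funeneg].
apply/funext => x /=; rewrite /Rintegral integralE.
by congr (fine (_ - _)%E); apply: eq_integral => y _; rewrite ?funeposE ?funenegE.
Qed.

Lemma Rintegral_fubini (F : T1 * T2 -> R) :
  (m1 \x m2)%E.-integrable [set: T1 * T2] (EFin \o F) ->
  m1.-integrable [set: T1]
    (EFin \o (fun x => Rintegral m2 [set: T2] (fun y => F (x, y)))) /\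
  Rintegral m1 [set: T1] (fun x => Rintegral m2 [set: T2] (fun y => F (x, y)))
  = Rintegral (m1 \x m2)%E [set: T1 * T2] F.
Proof.
move=> iF; have mF : measurable_fun setT F.
  by apply/measurable_EFinP; exact: measurable_int iF.
(* Almost every section is integrable, hence has a finite integral on which [fine] loses nothing. *)
have aeE : ae_eq m1 setT (fubini_F m2 (EFin \o F))
   (EFin \o (fun x => Rintegral m2 [set: T2] (fun y => F (x, y)))).
  have := ae_integrable1 iF; apply: filterS => x ix _ /=.
  by rewrite /Rintegral fineK// integrable_fin_num.
split.
  apply: ae_eq_integrable aeE (integrable_fubini_F iF) => //.
  exact/measurable_EFinP/measurable_Rintegral_section.
rewrite /Rintegral; congr fine; rewrite -integral12_prod_meas1//.
apply/esym/ae_eq_integral => //.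
  exact: (measurable_fubini_F iF).
exact/measurable_EFinP/measurable_Rintegral_section.
Qed.

Lemma Rintegral_fubini_swap (F : T1 * T2 -> R) :
  (m1 \x m2)%E.-integrable [set: T1 * T2] (EFin \o F) ->
  Rintegral m2 [set: T2] (fun y => Rintegral m1 [set: T1] (fun x => F (x, y)))
  = Rintegral (m1 \x m2)%E [set: T1 * T2] F.
Proof.
move=> iF; have mF : measurable_fun setT F.
  by apply/measurable_EFinP; exact: measurable_int iF.
rewrite /Rintegral; congr fine; rewrite -integral21_prod_meas1//.
apply: ae_eq_integral => //.
- have mG : measurable_fun setT (fubini_G m1 (EFin \o F)).
    exact: (measurable_fubini_G iF).
  by apply/measurable_EFinP; exact: (measurableT_comp (fine_measurable measurableT) mG).
- exact: (measurable_fubini_G iF).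
- have := ae_integrable2 iF; apply: filterS => x ix _ /=.
  by rewrite fineK// integrable_fin_num.
Qed.

Lemma Rintegral_weighted_fubini (g : T1 -> R) (F : T1 * T2 -> R) :
  measurable_fun [set: T1] g -> measurable_fun [set: T1 * T2] F ->
  (m1 \x m2)%E.-integrable [set: T1 * T2] (EFin \o (fun u => g u.1 * F u)) ->
  m1.-integrable [set: T1]
    (EFin \o (fun x => g x * Rintegral m2 [set: T2] (fun y => F (x, y)))) /\
  Rintegral m1 [set: T1] (fun x => g x * Rintegral m2 [set: T2] (fun y => F (x, y)))
  = Rintegral (m1 \x m2)%E [set: T1 * T2] (fun u => g u.1 * F u).
Proof.
move=> mg mF iF; have [i1 <-] := Rintegral_fubini iF.
have m' : measurable_fun setT
    (EFin \o (fun x => g x * Rintegral m2 [set: T2] (fun y => F (x, y)))).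
  apply/measurable_EFinP/measurable_funM => //.
  exact: measurable_Rintegral_section.
have aeE : ae_eq m1 setT
  (EFin \o (fun x => Rintegral m2 [set: T2] (fun y => g x * F (x, y))))
  (EFin \o (fun x => g x * Rintegral m2 [set: T2] (fun y => F (x, y)))).
  have := ae_integrable1 iF; apply: filterS => x /= ix _ /=; congr EFin.
  (* Where [g x] vanishes, the section of [F] itself may fail to be integrable, but both sides are
     0; elsewhere its integrability follows on dividing by [g x]. *)
  have [->|gx0] := eqVneq (g x) 0.
    rewrite mul0r /Rintegral; under eq_integral do rewrite mul0r.
    by rewrite integral0.
  rewrite RintegralZl//.
  have := integrableZl measurableT (g x)^-1 ix; apply: eq_integrable => //.
  by move=> y _ /=; rewrite -EFinM mulrA mulVf// mul1r.
split; first exact: (ae_eq_integrable _ m' aeE).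
rewrite /Rintegral; congr fine; apply/esym/ae_eq_integral => //.
exact: measurable_int i1.
Qed.

End RFubini.

(** * Borel sets and Lebesgue measure on R^n *)

Section Rn_borel.
Variables (R : realType) (n : nat).
Local Notation E := (Rn R n).

Definition box (a b : 'rV[R]_n) : set E :=
  [set y : E | forall i, a ord0 i <= y ord0 i < b ord0 i].

Lemma continuous_measurable_Rn (g : 'rV[R]_n -> R) :
  continuous g -> measurable_fun [set: E] (g : E -> R).
Proof.
move=> cg; apply: (@measurability _ _ E R setT g _ (RGenOInfty.measurableE R)).
move=> _ [_ [x ->] <-]; rewrite setTI.
apply: sub_sigma_algebra; apply: open_comp; last exact: interval_open.
by move=> y _; exact: cg.
Qed.

Lemma measurable_coord (i : 'I_n) :
  measurable_fun [set: E] (fun y : E => y ord0 i).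
Proof. by apply: continuous_measurable_Rn; exact: coord_continuous. Qed.

Lemma measurable_translation (v : 'rV[R]_n) :
  measurable_fun [set: E] (fun y : E => (y + v : 'rV[R]_n) : E).
Proof.
apply: (@measurability _ _ E E _ _ (@open 'rV[R]_n)) => //.
move=> _ [U oU <-]; rewrite setTI.
apply: sub_sigma_algebra.
apply: (@open_comp _ _ (fun y : 'rV[R]_n => y + v)) => //.
by move=> y _; apply: continuousD; [exact: cvg_id|exact: cst_continuous].
Qed.

Lemma measurable_box (a b : 'rV[R]_n) : measurable (box a b).
Proof.
rewrite (_ : box a b = \bigcap_(i : 'I_n)
   ((fun y : E => y ord0 i) @^-1` `[a ord0 i, b ord0 i[%classic)); last first.
  apply/seteqP; split => y /= H i; first by move=> _ /=; rewrite in_itv/=.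
  by have := H i I; rewrite /= in_itv.
apply: fin_bigcap_measurable => // i _.
rewrite -[X in measurable X]setTI.
exact: (measurable_coord i).
Qed.

Definition boxes : set (set E) := [set A | exists a b, A = box a b].

Lemma boxes_setI : setI_closed boxes.
Proof.
move=> _ _ [a [b ->]] [c [d ->]].
exists (\row_i Num.max (a ord0 i) (c ord0 i)), (\row_i Num.min (b ord0 i) (d ord0 i)).
apply/seteqP; split => y /=.
  move=> [H1 H2] i; rewrite !mxE ge_max lt_min.
  by have /andP[-> ->] := H1 i; have /andP[-> ->] := H2 i.
move=> H; split => i; have := H i; rewrite !mxE ge_max lt_min.
  by case/andP => /andP[-> _] /andP[-> _].
by case/andP => /andP[_ ->] /andP[_ ->].
Qed.

(** Half-open boxes are not open, yet those with rational corners contained in [U] cover it: around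
    each point, corners can be picked inside a sup-norm ball. There are countably many of them. *)
Lemma open_generated_boxes (U : set 'rV[R]_n) : open U -> <<s boxes >> U.
Proof.
move=> oU.
pose B (q : 'rV[rat]_n * 'rV[rat]_n) : set E :=
  box (map_mx ratr q.1) (map_mx ratr q.2).
pose C q : set E := if `[< B q `<=` U >] then B q else set0.
have -> : U = \bigcup_q C q.
  apply/seteqP; split => [y Uy|y [q _]]; last first.
    by rewrite /C; case: asboolP => // + By; apply.
  have /nbhs_ballP[e /= e0 eU] := open_nbhs_nbhs (conj oU Uy).
  have /choice[a Ha] : forall i, exists q, ratr q \in `]y ord0 i - e, y ord0 i[.
    move=> i; have := @rat_in_itvoo R (y ord0 i - e) (y ord0 i).
    by rewrite ltrBlDr ltrDl => /(_ e0)[q ?]; exists q.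
  have /choice[b Hb] : forall i, exists q, ratr q \in `]y ord0 i, y ord0 i + e[.
    move=> i; have := @rat_in_itvoo R (y ord0 i) (y ord0 i + e).
    by rewrite ltrDl => /(_ e0)[q ?]; exists q.
  exists (\row_i a i, \row_i b i) => //; rewrite /C.
  have ByU : B (\row_i a i, \row_i b i) `<=` U.
    move=> z Bz; apply: eU; split => // i j; rewrite ord1.
    have := Bz j; rewrite !mxE => /andP[h1 h2].
    have := Ha j; rewrite in_itv/= => /andP[h3 h4].
    have := Hb j; rewrite in_itv/= => /andP[h5 h6].
    by rewrite /ball/= ltr_norml; apply/andP; split; lra.
  rewrite asboolT// => i; rewrite !mxE.
  have := Ha i; rewrite in_itv/= => /andP[h3 h4].
  have := Hb i; rewrite in_itv/= => /andP[h5 h6].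
  by apply/andP; split => //; exact: ltW.
apply: (@countable_bigcupT_measurable _ (g_sigma_algebraType boxes)) => // q.
rewrite /C; case: asboolP => _; last exact: measurable0.
by apply: sub_sigma_algebra; exists (map_mx ratr q.1), (map_mx ratr q.2).
Qed.

Lemma Rn_measurableE : @measurable _ E = <<s boxes >>.
Proof.
apply/seteqP; split.
  apply: smallest_sub; first exact: smallest_sigma_algebra.
  exact: open_generated_boxes.
apply: smallest_sub; first exact: sigma_algebra_measurable.
by move=> _ [a [b ->]]; exact: measurable_box.
Qed.

Definition cube (x : 'rV[R]_n) (r : R) : set E :=
  box (\row_i (x ord0 i - r)) (\row_i (x ord0 i + r)).

Lemma bigcup_cube : \bigcup_k (cube 0 k%:R) = [set: E].
Proof.
apply/seteqP; split => // y _.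
have [k Hk] : exists k : nat, forall i : 'I_n, `|y ord0 i : R| < k%:R.
  exists (Num.truncn (\sum_(i < n) `|y ord0 i : R|)).+1 => i.
  apply: le_lt_trans (truncnS_gt _).
  by rewrite (bigD1 i)//= lerDl sumr_ge0.
exists k => // i; rewrite !mxE sub0r add0r.
by have := Hk i; rewrite ltr_norml => /andP[/ltW -> ->].
Qed.

Variable (lam : {measure set E -> \bar R}).
Hypothesis Hlam : is_lebesgue_Rn lam.

Lemma lebesgue_box (a b : 'rV[R]_n) : (forall i, a ord0 i <= b ord0 i) ->
  lam (box a b) = (\prod_(i < n) (b ord0 i - a ord0 i))%:E.
Proof. exact: Hlam. Qed.

Lemma lebesgue_cube (x : 'rV[R]_n) (r : R) : 0 <= r ->
  lam (cube x r) = ((2 * r) ^+ n)%:E.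
Proof.
move=> r0; rewrite lebesgue_box; last by move=> i; rewrite !mxE; lra.
congr EFin; rewrite -[in RHS](card_ord n) -prodr_const.
by apply: eq_bigr => i _; rewrite !mxE; ring.
Qed.

Lemma lebesgue_sigma_finite : sigma_finite [set: E] lam.
Proof.
exists (fun k => cube 0 k%:R); first by rewrite bigcup_cube.
by move=> k; split; [exact: measurable_box|rewrite lebesgue_cube// ltry].
Qed.

(** Uniqueness of measures: [lam] and its image under the translation agree on the boxes, an
    intersection-stable generating family that contains an exhaustion by cubes of finite measure. *)
Lemma lebesgue_translation (v : 'rV[R]_n) (A : set E) : measurable A ->
  lam ((fun y : E => (y + v : 'rV[R]_n) : E) @^-1` A) = lam A.
Proof.
move=> mA.
set T := (fun y : E => _).
have mT := measurable_translation v.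
pose m2 : {measure set E -> \bar R} := 
  measure_function_pushforward__canonical__measure_function_Measure lam mT.
apply/esym; apply: (@measure_unique _ R E boxes (fun k => cube 0 k%:R) _ _ _ _ lam m2) => //.
- exact: Rn_measurableE.
- exact: boxes_setI.
- by move=> k; do 2 eexists.
- exact: bigcup_cube.
- move=> _ [a [b ->]]; rewrite /m2 /= /pushforward.
  have -> : T @^-1` box a b = box (a - v) (b - v).
    by apply/seteqP; split => y H i; have := H i; rewrite /T !mxE lerBlDr ltrBrDr.
  have [ab|/existsNP[i /negP]] := pselect (forall i, a ord0 i <= b ord0 i).
    rewrite !lebesgue_box//; last by move=> i; rewrite !mxE lerD2r.
    by congr EFin; apply: eq_bigr => i _; rewrite !mxE; ring.
  rewrite -ltNge => ab.
  (* A box with a reversed side falls outside the volume formula, but it is empty and so is its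
     translate. *)
  have e (c d : 'rV[R]_n) : d ord0 i < c ord0 i -> box c d = set0.
    move=> dc; apply/seteqP; split => // y /(_ i) /andP[h1 h2].
    by have := lt_trans (le_lt_trans h1 h2) dc; rewrite ltxx.
  by rewrite !e// !mxE ltrD2r.
- by move=> k; rewrite lebesgue_cube// ltry.
Qed.

End Rn_borel.

(** * Smooth bump functions *)

Section flat_exponential.
Variable R : realType.

(* t^-m exp(-1/t) for t > 0: the span of these functions is stable under
   differentiation, the derivative of flat m being
   flat (m + 2) - m * flat (m + 1). *)
Definition flat (m : nat) (t : R) : R :=
  if 0 < t then t^-1 ^+ m * expR (- t^-1) else 0.

Lemma expR_ge_monomial (k : nat) (s : R) : 0 <= s -> s ^+ k / k`!%:R <= expR s.
Proof.
case: k => [|k] s0.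
  by rewrite expr0 fact0 divr1 (le_trans _ (expR_ge1Dx s))// lerDl.
by apply: le_trans (expR_ge1Dxn k s0); rewrite lerDr.
Qed.

Lemma flat_ge0 m t : 0 <= flat m t.
Proof.
rewrite /flat; case: ifPn => // t0.
by rewrite mulr_ge0 ?expR_ge0// exprn_ge0// invr_ge0 ltW.
Qed.

(** Comes from [e^s >= s^(m+2) / (m+2)!] at [s = 1/t]. The quadratic decay forces the difference
    quotient at 0 to tend to 0. *)
Lemma flat_le_sqr m t : flat m t <= (m + 2)`!%:R * t ^+ 2.
Proof.
rewrite /flat; case: ifPn => t0; last by rewrite mulr_ge0 ?sqr_ge0.
have tV0 : 0 < t^-1 by rewrite invr_gt0.
have := expR_ge_monomial (m + 2) (ltW tV0).
rewrite ler_pdivrMr ?ltr0n ?fact_gt0// exprD => H.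
rewrite expRN -ler_pdivlMr ?invr_gt0 ?expR_gt0// invrK.
rewrite -(@ler_pM2r _ (t^-1 ^+ 2)) ?exprn_gt0//.
apply: le_trans H _.
rewrite le_eqVlt; apply/orP; left; apply/eqP.
by field; rewrite gt_eqF.
Qed.

(** The case [m = 0] bounds [flat 0] by 1; the case [m = 2] bounds its derivative [flat 2] by 2,
    hence the Lipschitz constant below. *)
Lemma flat_le (m : nat) (t : R) : flat m t <= m`!%:R.
Proof.
rewrite /flat; case: ifPn => t0; last by [].
have tV0 : 0 < t^-1 by rewrite invr_gt0.
have := expR_ge_monomial m (ltW tV0).
by rewrite ler_pdivrMr ?ltr0n ?fact_gt0// expRN ler_pdivrMr ?expR_gt0// mulrC.
Qed.

Lemma is_derive_flat (m : nat) (t : R) :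
  is_derive t (1 : R) (flat m) (flat m.+2 t - m%:R * flat m.+1 t).
Proof.
have [t0|t0|->] := ltgtP t 0.
- have -> : flat m.+2 t - m%:R * flat m.+1 t = 0.
    by rewrite /flat ltNge (ltW t0)/= mulr0 subr0.
  apply: (@near_eq_is_derive R R^o R^o (cst 0) (flat m) t 1) => //.
  + near=> s; rewrite /flat ifF//; apply/negbTE; rewrite -leNgt ltW//.
    by near: s; exact: lt_nbhsl.
- apply: (@near_eq_is_derive R R^o R^o (fun s => s^-1 ^+ m * expR (- s^-1)) (flat m) t 1).
  + near=> s; rewrite /flat ifT//.
    by near: s; exact: lt_nbhsr.
  + have tn0 : t != 0 by rewrite gt_eqF.
    have dV : is_derive t (1 : R) (fun s : R => s^-1) (- t ^- 2).
      by have := is_deriveV tn0 (is_derive_id t (1 : R)); rewrite [_ *: _]mulr1.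
    have d1 : is_derive t (1 : R) (fun s : R => expR (- s^-1))
        (expR (- t^-1) * t ^- 2).
      have dN : is_derive t (1 : R) (fun s : R => - s^-1) (t ^- 2).
        by rewrite -[t ^- 2]opprK; exact: is_deriveN.
      exact: (is_derive1_comp (is_derive_expR _) dN).
    have d2 := is_deriveX m dV.
    have := is_deriveM d2 d1.
    rewrite (_ : _ * _ = (fun s : R => s^-1 ^+ m * expR (- s^-1))); last first.
      by apply/funext => s; rewrite mulrfctE exprfctE.
    move/trigger_derive; apply.
    rewrite exprfctE /flat t0 /GRing.scale /=.
    case: m {d2} => [|k]; first by rewrite /= !expr0 !mul0r; field.
    by rewrite /= -!exprVn !exprS; ring.
- rewrite {2 3}/flat !ltxx mulr0 subr0.
  have H : h^-1 *: (flat m (h *: (1 : R) + 0) - flat m 0) @[h --> (0 : R)^'] --> (0 : R).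
    apply/cvgr0Pnorm_le => e e0.
    have C0 : 0 < (m + 2)`!%:R :> R by rewrite ltr0n fact_gt0.
    near=> h.
    have h0 : h != 0 by near: h; exact: nbhs_dnbhs_neq.
    rewrite {2}/flat ltxx subr0 addr0 normrM normfV.
    rewrite ler_pdivrMl ?normr_gt0// (ger0_norm (flat_ge0 _ _)).
    apply: le_trans (flat_le_sqr _ _) _; rewrite [_ *: _]mulr1.
    rewrite -real_normK ?num_real// expr2 mulrA mulrC ler_wpM2l//.
    rewrite mulrC -ler_pdivlMr//.
    near: h; apply: dnbhs0_le; exact: divr_gt0.
  apply: DeriveDef; first by apply/cvg_ex; exists 0; exact: H.
  by rewrite /derive; apply: cvg_lim => //; exact: H.
Unshelve. all: by end_near.
Qed.

Lemma continuous_flat (m : nat) : continuous (flat m).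
Proof.
move=> t; apply/differentiable_continuous/derivable1_diffP.
by have [] := is_derive_flat m t.
Qed.

Lemma flat_lipschitz (s t : R) : `|flat 0 s - flat 0 t| <= 2 * `|s - t|.
Proof.
wlog st : s t / s <= t.
  move=> H; have [/H//|/ltW/H] := leP s t.
  by rewrite distrC [X in _ <= _ * X -> _]distrC.
have := @MVT_segment R (flat 0) (fun t => flat 2 t - 0%:R * flat 1 t) s t st.
case=> [x _|| c _ H]; first exact: is_derive_flat.
  by apply: continuous_subspaceT; exact: continuous_flat.
rewrite distrC H mul0r subr0 normrM ger0_norm ?flat_ge0// (distrC s).
by rewrite ler_wpM2r// (flat_le 2 c).
Qed.

Lemma flat_gt0 (m : nat) (t : R) : (0 < flat m t) = (0 < t).
Proof.
rewrite /flat; case: ifPn => [t0|]; last by rewrite ltxx.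
by rewrite mulr_gt0 ?expR_gt0// exprn_gt0// invr_gt0.
Qed.

End flat_exponential.

(** * An algebra of smooth functions and the bumps it contains *)

Section smooth_algebra.
Variables (R : realType) (n : nat).
Implicit Types (f g : 'rV[R]_n -> R) (e : R) (u v : 'rV[R]_n).

(** A class of continuous functions closed under directional derivatives, so that every member is
    smooth and no iterated derivative has to be computed. *)
Inductive smooth_alg : ('rV[R]_n -> R) -> Prop :=
| smooth_alg_cst c : smooth_alg (fun=> c)
| smooth_alg_flat m a c j : smooth_alg (fun x => flat m (a + c * x ord0 j))
| smooth_alg_add f g : smooth_alg f -> smooth_alg g ->
    smooth_alg (fun x => f x + g x)
| smooth_alg_mul f g : smooth_alg f -> smooth_alg g ->
    smooth_alg (fun x => f x * g x).

Lemma continuous_smooth_alg f : smooth_alg f -> continuous f.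
Proof.
elim => [c|m a c j|{}f g _ cf _ cg|{}f g _ cf _ cg].
- exact: cst_continuous.
- move=> x; apply: (@continuous_comp _ _ _ (fun x : 'rV[R]_n => a + c * x ord0 j)).
    apply: continuousD; first exact: cst_continuous.
    apply: continuousM; first exact: cst_continuous.
    exact: coord_continuous.
  exact: continuous_flat.
- by move=> x; apply: continuousD; [exact: cf|exact: cg].
- by move=> x; apply: continuousM; [exact: cf|exact: cg].
Qed.

(** Brings a directional derivative down to one real variable, where the chain rule for [flat]
    applies. *)
Lemma is_derive_line f (x v : 'rV[R]_n) (l : R) :
  is_derive 0 (1 : R) (fun h : R => f (h *: v + x)) l -> is_derive x v f l.
Proof.
move=> [d1 d2]; apply: DeriveDef; first exact/derivable1P.
rewrite -d2 /derive.
suff -> : (fun h : R => h^-1 *: ((f \o shift x) (h *: v) - f x)) =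
  (fun h : R => h^-1 *: (((fun h : R => f (h *: v + x)) \o shift 0) (h *: (1 : R))
     - f (0 *: v + x))) by [].
by apply/funext => h /=; rewrite addr0 scale0r add0r [h *: 1]mulr1.
Qed.

Lemma smooth_alg_is_derive f (v : 'rV[R]_n) : smooth_alg f ->
  exists2 g, smooth_alg g & forall x, is_derive x v f (g x).
Proof.
elim => [c|m a c j|{}f g sf [f' sf' df] sg [g' sg' dg]|{}f g sf [f' sf' df] sg [g' sg' dg]].
- by exists (fun=> 0); [exact: smooth_alg_cst|move=> x; exact: is_derive_cst].
- exists (fun x => (flat m.+2 (a + c * x ord0 j) +
     - m%:R * flat m.+1 (a + c * x ord0 j)) * (c * v ord0 j)).
    apply: smooth_alg_mul; last exact: smooth_alg_cst.
    apply: smooth_alg_add; first exact: smooth_alg_flat.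
    by apply: smooth_alg_mul; [exact: smooth_alg_cst|exact: smooth_alg_flat].
  move=> x; apply: is_derive_line.
  pose A (h : R) := (a + c * x ord0 j) + h * (c * v ord0 j).
  rewrite (_ : (fun h => _) = flat m \o A); last first.
    by apply/funext => h; rewrite /A/= !mxE; congr flat; ring.
  have dA : is_derive (0 : R) (1 : R) A (c * v ord0 j).
    have dB : is_derive (0 : R) (1 : R) (fun h : R => h * (c * v ord0 j)) (c * v ord0 j).
      have := is_deriveM (is_derive_id 0 (1 : R)) (is_derive_cst (c * v ord0 j) 0 (1 : R)).
      by move/trigger_derive; apply; rewrite scaler0 add0r [_ *: _]mulr1.
    have := is_deriveD (is_derive_cst (a + c * x ord0 j) 0 (1 : R)) dB.
    by rewrite add0r.
  have := is_derive1_comp (is_derive_flat m (A 0)) dA.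
  by rewrite /A mul0r addr0 mulNr.
- exists (fun x => f' x + g' x); first exact: smooth_alg_add.
  by move=> x; exact: (is_deriveD (df x) (dg x)).
- exists (fun x => f x * g' x + g x * f' x).
    by apply: smooth_alg_add; exact: smooth_alg_mul.
  by move=> x; exact: (is_deriveM (df x) (dg x)).
Qed.

Lemma smooth_alg_smooth f : smooth_alg f -> smooth f.
Proof.
move=> sf s.
have H : smooth_alg (iter_dir f s).
  elim: s => //= v s ih; have [g sg dg] := smooth_alg_is_derive v ih.
  rewrite (_ : (fun a => _) = g)//; apply/funext => a.
  by have [] := dg a.
split; first exact: continuous_smooth_alg.
by move=> a v; have [g _ /(_ a)[]] := smooth_alg_is_derive v H.
Qed.

Lemma smooth_alg_prod (I : Type) (s : seq I) (F : I -> 'rV[R]_n -> R) :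
  (forall i, smooth_alg (F i)) -> smooth_alg (fun x => \prod_(i <- s) F i x).
Proof.
move=> HF; elim: s => [|i s ih].
  by under eq_fun do rewrite big_nil; exact: smooth_alg_cst.
by under eq_fun do rewrite big_cons; exact: smooth_alg_mul.
Qed.

(** A product over coordinates instead of a radial bump: it stays in [smooth_alg] and is positive
    exactly on the open sup-norm cube of half-side [e]. Its integral is normalised only in
    [moll]. *)
Definition bumpf (e : R) (u : 'rV[R]_n) : R :=
  \prod_(j < n) (flat 0 (1 + u ord0 j / e) * flat 0 (1 - u ord0 j / e)).

Lemma smooth_alg_bump (e : R) (w : 'rV[R]_n) :
  smooth_alg (fun x => bumpf e (w - x)).
Proof.
apply: smooth_alg_prod => j.
apply: smooth_alg_mul.
  rewrite [X in smooth_alg X](_ : _ = (fun x : 'rV[R]_n => flat 0 ((1 + w ord0 j / e) + - e^-1 * x ord0 j))).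
    exact: smooth_alg_flat.
  by apply/funext => x; rewrite !mxE; congr flat; ring.
rewrite [X in smooth_alg X](_ : _ = (fun x : 'rV[R]_n => flat 0 ((1 - w ord0 j / e) + e^-1 * x ord0 j))).
  exact: smooth_alg_flat.
by apply/funext => x; rewrite !mxE; congr flat; ring.
Qed.

Lemma bump_ge0 e u : 0 <= bumpf e u.
Proof. by apply: prodr_ge0 => j _; rewrite mulr_ge0// flat_ge0. Qed.

Lemma bump_le1 e u : bumpf e u <= 1.
Proof.
apply: prodr_ile1 => j _; rewrite mulr_ge0 ?flat_ge0//=.
by rewrite mulr_ile1 ?flat_ge0// (flat_le 0).
Qed.

Lemma bump_gt0 e u : 0 < e ->
  reflect (forall j, `|u ord0 j| < e) (0 < bumpf e u).
Proof.
move=> e0; have eq0 : e != 0 by rewrite gt_eqF.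
have P t : (0 < 1 + t / e) = (- e < t) /\ (0 < 1 - t / e) = (t < e).
  rewrite -{1 2}(divff eq0) -mulrDl -mulrBl !pmulr_lgt0 ?invr_gt0//.
  by rewrite subr_gt0 addrC -(subr_gt0 (- e)) opprK.
apply: (iffP idP) => [H j|H].
  have : flat 0 (1 + u ord0 j / e) * flat 0 (1 - u ord0 j / e) != 0.
    by move: H; rewrite lt0r /bumpf => /andP[/prodf_neq0/(_ j isT)].
  rewrite mulf_eq0 negb_or => /andP[h1 h2]; rewrite ltr_norml.
  have : 0 < 1 + u ord0 j / e by rewrite -(flat_gt0 0) lt0r h1 flat_ge0.
  have : 0 < 1 - u ord0 j / e by rewrite -(flat_gt0 0) lt0r h2 flat_ge0.
  by rewrite (P _).1 (P _).2 => -> ->.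
apply: prodr_gt0 => j _; have := H j; rewrite ltr_norml => /andP[h1 h2].
by rewrite mulr_gt0// flat_gt0 ?(P _).1 ?(P _).2.
Qed.

(** Telescoping: the factors are exchanged one at a time, all others being at most 1. *)
Lemma prod_dist_le (I : Type) (s : seq I) (F G : I -> R) :
  (forall i, 0 <= F i <= 1) -> (forall i, 0 <= G i <= 1) ->
  `|\prod_(i <- s) F i - \prod_(i <- s) G i| <= \sum_(i <- s) `|F i - G i|.
Proof.
move=> HF HG; elim: s => [|i s ih]; first by rewrite !big_nil subrr normr0.
rewrite !big_cons.
set A := \prod_(_ <- _) _ in ih *; set B := \prod_(_ <- _) _ in ih *.
have -> : F i * A - G i * B = (F i - G i) * A + G i * (A - B) by ring.
have A01 : 0 <= A <= 1.
  by rewrite prodr_ge0 ?prodr_ile1// => j _; have /andP[] := HF j.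
apply: le_trans (ler_normD _ _) _; rewrite !normrM; apply: lerD.
  by rewrite -[leRHS]mulr1 ler_wpM2l// ger0_norm; case/andP: A01.
apply: le_trans ih; rewrite -[leRHS]mul1r ler_wpM2r//.
by have /andP[h1 h2] := HG i; rewrite ger0_norm.
Qed.

(** Each coordinate enters two factors [flat 0], each Lipschitz with constant [2 / e] after
    rescaling; hence the 4. *)
Lemma bump_lipschitz e u v : 0 < e ->
  `|bumpf e u - bumpf e v| <= 4 / e * \sum_(j < n) `|u ord0 j - v ord0 j|.
Proof.
move=> e0; have F01 (t : R) : 0 <= flat 0 t <= 1 by rewrite flat_ge0 (flat_le 0).
have M01 (a b : R) : 0 <= a <= 1 -> 0 <= b <= 1 -> 0 <= a * b <= 1.
  by move=> /andP[? ?] /andP[? ?]; rewrite mulr_ge0//= mulr_ile1.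
apply: le_trans (prod_dist_le _ _ _) _; [by move=> j; exact: M01..|].
rewrite mulr_sumr; apply: ler_sum => j _.
set a := flat 0 _; set b := flat 0 _; set c := flat 0 _; set d := flat 0 _.
have -> : a * b - c * d = (a - c) * b + c * (b - d) by ring.
have H1 : `|a - c| <= 2 / e * `|u ord0 j - v ord0 j|.
  apply: le_trans (flat_lipschitz _ _) _; rewrite -mulrA ler_wpM2l//.
  rewrite (_ : 1 + _ - _ = e^-1 * (u ord0 j - v ord0 j)); last by ring.
  by rewrite normrM ger0_norm// invr_ge0 ltW.
have H2 : `|b - d| <= 2 / e * `|u ord0 j - v ord0 j|.
  apply: le_trans (flat_lipschitz _ _) _; rewrite -mulrA ler_wpM2l//.
  rewrite (_ : 1 - _ - _ = - (e^-1 * (u ord0 j - v ord0 j))); last by ring.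
  by rewrite normrN normrM ger0_norm// invr_ge0 ltW.
apply: le_trans (ler_normD _ _) _; rewrite !normrM.
have /andP[b0 b1] : 0 <= b <= 1 by exact: F01.
have /andP[c0 c1] : 0 <= c <= 1 by exact: F01.
rewrite (ger0_norm b0) (ger0_norm c0).
have -> : 4 / e = 2 / e + 2 / e by field; rewrite gt_eqF.
rewrite mulrDl; apply: lerD.
  by apply: le_trans H1; rewrite -[leRHS]mulr1 ler_wpM2l.
by apply: le_trans H2; rewrite -[leRHS]mul1r ler_wpM2r.
Qed.

Lemma compact_support_bounded (psi : 'rV[R]_n -> 'rV[R]_n) (M : R) :
  (forall x, psi x != 0 -> forall j, `|x ord0 j| <= M) -> compact_support psi.
Proof.
move=> H.
have Kc : compact [set v : 'rV[R]_n | forall i, v ord0 i \in `[- M, M]].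
  apply: (@rV_compact _ _ (fun=> `[- M, M]%classic)).
  by move=> _; apply: segment_compact.
apply: (subclosed_compact _ Kc); first exact: closed_closure.
rewrite closureE; apply: smallest_sub; last first.
  by move=> x /= /H{}H i; rewrite in_itv/= -ler_norml.
by apply: compact_closed => //; exact: norm_hausdorff.
Qed.

Lemma le_coord_mx_norm (x : 'rV[R]_n) (j : 'I_n) : `|x ord0 j| <= `|x|.
Proof.
rewrite [leRHS]/Num.norm /= mx_normrE.
exact: (@le_bigmax _ _ _ 0 (fun ij : 'I_1 * 'I_n => `|x ij.1 ij.2|) (ord0, j)).
Qed.

Lemma bounded_compact_support (psi : 'rV[R]_n -> 'rV[R]_n) :
  compact_support psi ->
  exists2 M, 0 < M & forall x, psi x != 0 -> forall j, `|x ord0 j| <= M.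
Proof.
move=> /compact_bounded[M [_ HM]].
exists (`|M| + 1) => [|x px j]; first by rewrite ltr_pwDr.
have : `|x| <= `|M| + 1.
  apply: HM; last exact: subset_closure.
  by rewrite (le_lt_trans (ler_norm M))// ltrDl.
by apply: le_trans; exact: (le_coord_mx_norm x).
Qed.

End smooth_algebra.

(** * The singular kernel *)

Section euclidean_norm.
Variables (R : realType) (n : nat).
Implicit Types u v : 'rV[R]_n.

Lemma enorm_ge0 u : 0 <= enorm u.
Proof. exact: sqrtr_ge0. Qed.

Lemma enormN u : enorm (- u) = enorm u.
Proof.
by congr Num.sqrt; apply: eq_bigr => i _; rewrite !mxE mulrNN.
Qed.

Lemma dotv_ge0 u : 0 <= dotv u u.
Proof. by apply: sumr_ge0 => i _; rewrite -expr2 sqr_ge0. Qed.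

Lemma coord_le_enorm u i : `|u ord0 i| <= enorm u.
Proof.
rewrite -sqrtr_sqr ler_sqrt ?dotv_ge0// /dotv (bigD1 i)//= -expr2 lerDl.
by apply: sumr_ge0 => j _; rewrite -expr2 sqr_ge0.
Qed.

Lemma enorm_le_sum u : enorm u <= \sum_(i < n) `|u ord0 i|.
Proof.
have s0 : 0 <= \sum_(i < n) `|u ord0 i| by apply: sumr_ge0.
rewrite -[leRHS](ger0_norm s0) -sqrtr_sqr ler_sqrt ?sqr_ge0// expr2 mulr_suml.
apply: ler_sum => i _; apply: le_trans (ler_norm _) _; rewrite normrM.
by rewrite ler_wpM2l// (bigD1 i)//= lerDl; apply: sumr_ge0.
Qed.

(** The factor [n] avoids Cauchy-Schwarz: the difference of the squared norms is bounded coordinate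
    by coordinate, then divided by [|u| + |v|]. Only the existence of some constant matters
    later. *)
Lemma enorm_dist u v : `|enorm u - enorm v| <= n%:R * enorm (u - v).
Proof.
have [e0|] := eqVneq (enorm u + enorm v) 0.
  have := enorm_ge0 u; have := enorm_ge0 v => h1 h2.
  have -> : enorm u = 0 by apply/eqP; rewrite eq_le h2 -e0 lerDl h1.
  have -> : enorm v = 0 by apply/eqP; rewrite eq_le h1 -e0 lerDr h2.
  by rewrite subrr normr0 mulr_ge0// enorm_ge0.
move=> e0; have {}e0 : 0 < enorm u + enorm v.
  by rewrite lt0r e0 addr_ge0// enorm_ge0.
rewrite -(ler_pM2r e0) -{1}(gtr0_norm e0) -normrM -subr_sqr.
rewrite !sqr_sqrtr ?dotv_ge0// /dotv -sumrB.
apply: le_trans (ler_norm_sum _ _ _) _.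
rewrite -mulrA mulr_natl -[X in _ *+ X](card_ord n) -sumr_const.
apply: ler_sum => i _.
rewrite -!expr2 subr_sqr normrM; apply: ler_pM => //.
  by have := coord_le_enorm (u - v) i; rewrite !mxE.
by apply: le_trans (ler_normD _ _) _; apply: lerD; exact: coord_le_enorm.
Qed.

Lemma eball_subset_cube (x : 'rV[R]_n) (r : R) : eball x r `<=` cube x r.
Proof.
move=> y /= yr i; rewrite !mxE.
have := le_lt_trans (coord_le_enorm (y - x) i) yr.
by rewrite !mxE ltr_norml => /andP[h1 h2]; apply/andP; split; lra.
Qed.

End euclidean_norm.

(** * Dyadic estimate of the kernel integral *)

Section kernel.
Variables (R : realType) (n : nat) (alpha : R).
Hypotheses (n_gt0 : (0 < n)%N) (alpha01 : 0 < alpha < 1).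

(* The size of (z - y) (g z - g y) kern alpha y z for a bounded Lipschitz g,
   in terms of d = |z - y|. *)
Definition rker (d : R) : R :=
  Num.min 1 d * (d * (d `^ (n%:R + alpha + 1))^-1).

Lemma rker_ge0 d : 0 <= d -> 0 <= rker d.
Proof.
by move=> d0; rewrite !mulr_ge0// ?invr_ge0 ?powR_ge0// le_min d0 ler01.
Qed.

(** Growth rates per dyadic step: near distance [2^-j] the kernel is about [p1^j] on a volume of
    order [2^(-jn)], near distance [2^j] about [p2^-j] on a volume of order [2^(jn)]. Summability
    amounts to [p1 < 2^n < p2], which is [0 < alpha < 1]. *)
Let p1 : R := 2 `^ (n%:R + alpha - 1).
Let p2 : R := 2 `^ (n%:R + alpha).

Let p1_gt0 : 0 < p1. Proof. exact: powR_gt0. Qed.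
Let p2_gt0 : 0 < p2. Proof. exact: powR_gt0. Qed.
Let alpha_gt0 : 0 < alpha. Proof. by case/andP: alpha01. Qed.
Let alpha_lt1 : alpha < 1. Proof. by case/andP: alpha01. Qed.

Let n_ge1 : 1 <= n%:R :> R. Proof. by rewrite ler1n. Qed.

Let ltr_powR2 (a b : R) : a < b -> 2 `^ a < 2 `^ b :> R.
Proof.
move=> ab; rewrite -(subrK a b) powRD; last by rewrite pnatr_eq0 implybT.
rewrite ltr_pMl ?powR_gt0//.
have : 1 `^ (b - a) < 2 `^ (b - a) :> R.
  by apply: gt0_ltr_powR; rewrite ?subr_gt0 ?nnegrE ?ltr1n.
by rewrite powR1.
Qed.

Let p1_lt : p1 < 2 ^+ n.
Proof. by rewrite -powR_mulrn// ltr_powR2//; move: alpha_lt1; lra. Qed.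

Let p2_gt : 2 ^+ n < p2.
Proof. by rewrite -powR_mulrn// ltr_powR2//; move: alpha_gt0; lra. Qed.

Let powR2X (j : nat) (s : R) : (2 ^+ j) `^ s = (2 `^ s) ^+ j :> R.
Proof.
by rewrite -(powR_mulrn j)// powRAC powR_mulrn// powR_ge0.
Qed.

Lemma dyadic_shell (d : R) : 1 <= d -> exists j : nat, 2 ^+ j <= d < 2 ^+ j.+1.
Proof.
move=> d1.
have ex : exists m : nat, d < 2 ^+ m.
  exists (Num.truncn d).+1; apply: lt_le_trans (truncnS_gt d) _.
  by rewrite -natrX ler_nat ltnW// ltn_expl.
case: (ex_minnP ex) => -[|j] dj H; first by move: dj; rewrite expr0 ltNge d1.
exists j; rewrite dj andbT leNgt; apply/negP => /H.
by rewrite ltnn.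
Qed.

(** In this range [rker d] equals [d^(-n-alpha)]. *)
Lemma rker_large (d : R) j : 1 <= d -> 2 ^+ j <= d -> rker d <= (p2 ^+ j)^-1.
Proof.
move=> d1 jd; have d0 : 0 < d by apply: lt_le_trans d1.
rewrite /rker (min_idPl d1) mul1r powRD; last by rewrite (gt_eqF d0) implybT.
rewrite powRr1 ?(ltW d0)// invfM mulrCA divff ?gt_eqF// mulr1.
rewrite lef_pV2 ?posrE ?exprn_gt0 ?powR_gt0// -powR2X.
apply: ge0_ler_powR; rewrite ?nnegrE ?exprn_ge0 ?(ltW d0)//.
by rewrite addr_ge0// ltW.
Qed.

(** In this range [rker d] equals [(1/d)^(n+alpha-1)], monotone in [1/d] because [n >= 1] keeps the
    exponent nonnegative. *)
Lemma rker_small (d : R) j : 0 < d -> d <= 1 -> d^-1 < 2 ^+ j.+1 ->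
  rker d <= p1 ^+ j.+1.
Proof.
move=> d0 d1 jd; rewrite /rker (min_idPr d1).
have -> : n%:R + alpha + 1 = (n%:R + alpha - 1) + 2%:R by ring.
rewrite powRD; last by rewrite (gt_eqF d0) implybT.
rewrite powR_mulrn ?(ltW d0)// mulrA invfM mulrCA expr2 divff ?mulf_neq0 ?gt_eqF//.
rewrite mulr1 -powRN powRN -powR_inv1 ?powR_ge0// powRAC powR_inv1 ?(ltW d0)//.
rewrite -powR2X; apply: ge0_ler_powR; rewrite ?nnegrE ?exprn_ge0 ?invr_ge0 ?(ltW d0) ?(ltW jd)//.
by move: alpha_gt0 n_ge1; lra.
Qed.

Variable (lam : {measure set (Rn R n) -> \bar R}).
Hypothesis Hlam : is_lebesgue_Rn lam.

(** One index carries a small cube for short distances and a large one for long distances, so a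
    single series majorises both ranges. Full cubes replace the shells because their volume is given
    directly. *)
Definition rker_shell (j : nat) (y z : 'rV[R]_n) : R :=
  p1 ^+ j.+1 * \1_(cube y (2 * 2 ^- j)) z + (p2 ^+ j)^-1 * \1_(cube y (2 ^+ j.+1)) z.

Lemma rker_shell_ge0 j y z : 0 <= rker_shell j y z.
Proof.
by rewrite addr_ge0// mulr_ge0// ?invr_ge0 ?exprn_ge0 ?powR_ge0.
Qed.

Lemma rker_le_shell (y z : 'rV[R]_n) :
  exists j, rker (enorm (z - y)) <= rker_shell j y z.
Proof.
have := enorm_ge0 (z - y); rewrite le_eqVlt => /orP[/eqP <-|d0].
  by exists 0%N; rewrite /rker mul0r mulr0 rker_shell_ge0.
have [d1|d1] := leP 1 (enorm (z - y)).
  have [j /andP[j1 j2]] := dyadic_shell d1; exists j.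
  apply: le_trans (rker_large d1 j1) _.
  have zj : z \in cube y (2 ^+ j.+1) by rewrite inE; exact: eball_subset_cube.
  by rewrite /rker_shell !indicE zj mulr1 lerDr mulr_ge0 ?exprn_ge0 ?powR_ge0.
have [j /andP[j1 j2]] := dyadic_shell (ltW (ltac:(by rewrite invf_gt1) : 1 < (enorm (z - y))^-1)).
exists j; apply: le_trans (rker_small d0 (ltW d1) j2) _.
(* The distance is only known to be at most [2^-j]; the factor 2 makes the inequality strict, as the
   open ball demands. *)
have zj : z \in cube y (2 * 2 ^- j).
  rewrite inE; apply: eball_subset_cube; rewrite /eball/=.
  rewrite -(invrK (enorm _)) ltr_pdivlMr ?exprn_gt0// ltr_pdivrMl ?invr_gt0//.
  by rewrite (le_lt_trans j1)// ltr_pMr// ?invr_gt0// ltr1n.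
by rewrite /rker_shell !indicE zj mulr1 lerDl mulr_ge0 ?invr_ge0 ?exprn_ge0 ?powR_ge0.
Qed.

Lemma integral_scaled_indic (a : R) (A : set (Rn R n)) : 0 <= a -> measurable A ->
  (\int[lam]_z (a * \1_A z)%:E = a%:E * lam A)%E.
Proof.
move=> a0 mA; under eq_integral do rewrite EFinM.
rewrite ge0_integralZl//; first by rewrite integral_indic// setIT.
exact/measurable_EFinP/measurable_indic.
Qed.

Lemma measurable_shell (j : nat) (y : 'rV[R]_n) :
  measurable_fun [set: Rn R n] (fun z : Rn R n => (rker_shell j y z)%:E).
Proof.
by apply/measurable_EFinP; apply: measurable_funD; apply: measurable_funM => //;
  apply: measurable_indic; exact: measurable_box.
Qed.

Lemma integral_shell (j : nat) (y : 'rV[R]_n) :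
  (\int[lam]_z (rker_shell j y z)%:E =
   (p1 ^+ j.+1 * (2 * (2 * 2 ^- j)) ^+ n + (p2 ^+ j)^-1 * (2 * 2 ^+ j.+1) ^+ n)%:E)%E.
Proof.
have p10 k : 0 <= p1 ^+ k by rewrite exprn_ge0// powR_ge0.
have p20 k : 0 <= (p2 ^+ k)^-1 by rewrite invr_ge0 exprn_ge0// powR_ge0.
have mc y' r : measurable (cube y' r : set (Rn R n)) by exact: measurable_box.
rewrite /rker_shell; under eq_integral do rewrite EFinD.
rewrite ge0_integralD//.
- rewrite !integral_scaled_indic// !(lebesgue_cube Hlam)//.
- by move=> z _; rewrite lee_fin mulr_ge0.
- by apply/measurable_EFinP/measurable_funM => //; exact: measurable_indic.
- by move=> z _; rewrite lee_fin mulr_ge0.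
- by apply/measurable_EFinP/measurable_funM => //; exact: measurable_indic.
Qed.

(** Both cubes have side 4 times a power of 2, whence [4^n]. The inner terms are [4^n p1 q1^j] with
    [q1 = 2^(alpha-1)], the outer ones [4^n q2^j] with [q2 = 2^-alpha]. *)
Lemma shell_geometric : exists2 C : R, 0 <= C & forall N : nat,
  \sum_(0 <= j < N) (p1 ^+ j.+1 * (2 * (2 * 2 ^- j)) ^+ n +
    (p2 ^+ j)^-1 * (2 * 2 ^+ j.+1) ^+ n) <= C.
Proof.
have t0 : 0 < 2 ^+ n :> R by rewrite exprn_gt0.
pose q1 := p1 / 2 ^+ n; pose q2 := 2 ^+ n / p2; pose q := Num.max q1 q2.
pose A := 4 ^+ n * (p1 + 1).
have q10 : 0 < q1 by rewrite divr_gt0.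
have q20 : 0 < q2 by rewrite divr_gt0.
have q0 : 0 < q by rewrite lt_max q10.
have q1' : q < 1 by rewrite gt_max !ltr_pdivrMr// !mul1r p1_lt p2_gt.
have A0 : 0 <= A by rewrite mulr_ge0 ?exprn_ge0// addr_ge0// ltW.
exists (A * (1 - q)^-1) => [|N].
  by rewrite mulr_ge0// invr_ge0 subr_ge0 ltW.
apply: le_trans (geometric_le_lim N A0 q0 _); last by rewrite gtr0_norm.
rewrite /series /=; apply: ler_sum => j _.
have -> : p1 ^+ j.+1 * (2 * (2 * 2 ^- j)) ^+ n = 4 ^+ n * p1 * q1 ^+ j.
  rewrite /q1 expr_div_n -exprM mulnC exprM mulrA -natrM exprMn exprS exprVn.
  by rewrite mulrACA [in RHS]mulrA [4 ^+ n * p1]mulrC !mulrA; congr (_ * _); ring.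
have -> : (p2 ^+ j)^-1 * (2 * 2 ^+ j.+1) ^+ n = 4 ^+ n * q2 ^+ j.
  by rewrite /q2 expr_div_n -exprM mulnC exprM exprS mulrA -natrM exprMn mulrC mulrA.
rewrite /geometric/= /A mulrDr mulr1 mulrDl; apply: lerD.
  rewrite ler_wpM2l ?mulr_ge0 ?exprn_ge0 ?(ltW p1_gt0)//.
  by rewrite lerXn2r ?nnegrE ?(ltW q0) ?(ltW q10)// le_max lexx.
rewrite ler_wpM2l ?exprn_ge0// lerXn2r ?nnegrE ?(ltW q0) ?(ltW q20)//.
by rewrite le_max lexx orbT.
Qed.

Lemma measurable_enorm d (T : measurableType d) (F : T -> 'rV[R]_n) :
  (forall i, measurable_fun [set: T] (fun t => F t ord0 i)) ->
  measurable_fun [set: T] (fun t => enorm (F t)).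
Proof.
move=> mF; under eq_fun => t do rewrite /enorm -powR12_sqrt ?dotv_ge0//.
apply: (@measurableT_comp _ _ _ _ _ _ (@powR R ^~ 2^-1)) => //.
by apply: measurable_sum => i; exact: measurable_funM.
Qed.

Lemma measurable_rker d (T : measurableType d) (g : T -> R) :
  measurable_fun [set: T] g -> measurable_fun [set: T] (fun t => rker (g t)).
Proof.
move=> mg; under eq_fun do rewrite /rker -powRN.
apply: measurable_funM; first exact: measurable_minr.
apply: measurable_funM => //.
exact: (@measurableT_comp _ _ _ _ _ _ (@powR R ^~ _)).
Qed.

(** Pointwise the integrand is below one term of the shell series, hence below its sum, which is
    integrated termwise. The constant is uniform in [y] because the volume of a cube does not depend
    on its centre. *)
Lemma rker_integral_bound : exists2 C : R, 0 <= C & forall y : 'rV[R]_n,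
  (\int[lam]_z (rker (enorm (z - y)))%:E <= C%:E)%E.
Proof.
have [C C0 HC] := shell_geometric; exists C => // y.
apply: (@le_trans _ _ (\int[lam]_z \sum_(j <oo) (rker_shell j y z)%:E)%E).
  apply: ge0_le_integral => //.
  - by move=> z _; rewrite lee_fin rker_ge0// enorm_ge0.
  - apply/measurable_EFinP/measurable_rker/measurable_enorm => i.
    under eq_fun do rewrite !mxE.
    by apply: measurable_funB => //; exact: measurable_coord.
  - apply: ge0_emeasurable_sum => [j z _ _|j _]; first by rewrite lee_fin rker_shell_ge0.
    exact: measurable_shell.
  - move=> z _; have [j Hj] := rker_le_shell y z.
    apply: (@le_trans _ _ (rker_shell j y z)%:E); first by rewrite lee_fin.
    rewrite (@nneseriesD1 _ _ j)//=; last by move=> k _; rewrite lee_fin rker_shell_ge0.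
    by rewrite leeDl// nneseries_ge0// => k _ _; rewrite lee_fin rker_shell_ge0.
rewrite integral_nneseries//; last 2 first.
- by move=> j; exact: measurable_shell.
- by move=> j z _; rewrite lee_fin rker_shell_ge0.
apply: lime_le.
  by apply: is_cvg_nneseries => j _ _; apply: integral_ge0 => z _; rewrite lee_fin rker_shell_ge0.
apply: nearW => N; under eq_bigr do rewrite integral_shell.
by rewrite sumEFin lee_fin; exact: HC.
Qed.

End kernel.

(** * Integrability against functions in L^p *)

Section Lp_weight.
Context d (T : measurableType d) (R : realType) (mu : {measure set T -> \bar R}).
Local Open Scope ereal_scope.

(** For finite exponents, [|f| G <= G + C |f|^r]: integrability of [G] pays for the first term, its
    boundedness for the second. For the exponent infinity, [G] is multiplied by an essential bound
    of [f]. *)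
Lemma Lp_mul_bounded_integrable (f : T -> R) (G : T -> \bar R) (C : R) :
  measurable_fun [set: T] f -> measurable_fun [set: T] G -> (0 <= C)%R ->
  (forall x, 0 <= G x) -> (forall x, G x <= C%:E) -> \int[mu]_x G x < +oo ->
  forall p : \bar R, 1 < p -> Lnorm mu p (EFin \o f) < +oo ->
  \int[mu]_x (`|f x|%:E * G x) < +oo.
Proof.
move=> mf mG C0 G0 GC iG [r| |//] /=.
  rewrite lte_fin => r1; rewrite unlock /= => Lr.
  have r0 : (0 < r)%R by apply: lt_trans r1.
  have ir : \int[mu]_x (`|f x| `^ r)%:E < +oo.
    rewrite ltey; apply/negP => /eqP h; move: Lr; rewrite h.
    by rewrite poweRyr ?invr_neq0 ?gt_eqF.
  have mr : measurable_fun [set: T] (fun x => (`|f x| `^ r)%R).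
    apply: (@measurableT_comp _ _ _ _ _ _ (@powR R ^~ r)) => //.
    exact: measurableT_comp.
  apply: (@le_lt_trans _ _ (\int[mu]_x (G x + C%:E * (`|f x| `^ r)%:E))).
    apply: ge0_le_integral => //.
    - by move=> x _; rewrite mule_ge0.
    - apply: emeasurable_funM => //; apply/measurable_EFinP.
      exact: measurableT_comp.
    - apply: emeasurable_funD => //; apply: emeasurable_funM => //.
      exact/measurable_EFinP.
    - move=> x _; have : `|f x|%:E <= 1 + (`|f x| `^ r)%:E.
        rewrite -EFinD lee_fin; have [h|h] := leP `|f x|%R 1%R.
          by rewrite (le_trans h)// lerDl powR_ge0.
        by rewrite (le_trans (le1r_powR (ltW h) (ltW r1)))// lerDr.
      move=> /(lee_wpmul2r (G0 x)) h; apply: le_trans h _.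
      rewrite ge0_muleDl ?mul1e// ?lee_fin ?powR_ge0//.
      by rewrite leeD2l// muleC lee_wpmul2r// lee_fin powR_ge0.
  rewrite ge0_integralD//; last 2 first.
  - by move=> x _; rewrite mule_ge0// lee_fin// powR_ge0.
  - by apply: emeasurable_funM => //; exact/measurable_EFinP.
  rewrite ge0_integralZl//; last exact/measurable_EFinP.
  by rewrite lte_add_pinfty// lte_mul_pinfty// lee_fin.
rewrite unlock => _ L.
have [M M0 aeM] : exists2 M : R, (0 <= M)%R & {ae mu, forall x, (`|f x| <= M)%R}.
  (* On a space of measure 0 the norm is 0 by convention and says nothing about [f], but then any
     bound holds almost everywhere. *)
  move: L; case: ifPn => [_ L|]; last first.
    rewrite -leNgt measure_le0 => /eqP m0 _.
    by exists 0%R => //; exists [set: T]; split.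
  have := ess_sup_ge mu (abse \o (EFin \o f)).
  set e := ess_sup _ _ in L *; move: L; case: e => [M _ H|//|_ H].
    by exists `|M|%R => //; apply: filterS H => x /=; rewrite lee_fin => /le_trans; apply; exact: ler_norm.
  by exists 0%R => //; apply: filterS H => x /=.
apply: (@le_lt_trans _ _ (\int[mu]_x (M%:E * G x))).
  apply: ae_ge0_le_integral => //.
  - by move=> x _; rewrite mule_ge0.
  - apply: emeasurable_funM => //; apply/measurable_EFinP.
    exact: measurableT_comp.
  - by move=> x _; rewrite mule_ge0// lee_fin.
  - exact: emeasurable_funM.
  - by apply: filterS aeM => x fM _; rewrite lee_wpmul2r// lee_fin.
by rewrite ge0_integralZl// lte_mul_pinfty// lee_fin.
Qed.

End Lp_weight.

(** * An integrable majorant on pairs of points *)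

Section domination.
Variables (R : realType) (n : nat) (alpha : R).
Local Notation E := (Rn R n).
Hypotheses (n_gt0 : (0 < n)%N) (alpha01 : 0 < alpha < 1).
Variable lam : {sigma_finite_measure set E -> \bar R}.
Hypothesis Hlam : is_lebesgue_Rn lam.
Local Notation P := (lam \x lam)%E.
Variables (p : \bar R) (f : E -> R).
Hypotheses (p_gt1 : (1 < p)%E) (mf : measurable_fun [set: E] f).
Hypothesis Lf : (Lnorm lam p (EFin \o f) < +oo)%E.

Definition dist2 (u : E * E) : R := enorm ((u.2 : 'rV[R]_n) - u.1).

Definition qker (i : 'I_n) (u : E * E) : R :=
  ((u.2 : 'rV[R]_n) - u.1) ord0 i * kern alpha u.1 u.2.

Lemma measurable_diff_coord (i : 'I_n) :
  measurable_fun [set: E * E] (fun u : E * E => ((u.2 : 'rV[R]_n) - u.1) ord0 i).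
Proof.
under eq_fun do rewrite !mxE; apply: measurable_funB.
  exact: (measurableT_comp (measurable_coord i)).
exact: (measurableT_comp (measurable_coord i)).
Qed.

Lemma measurable_dist2 : measurable_fun [set: E * E] dist2.
Proof. by apply: measurable_enorm => i; exact: measurable_diff_coord. Qed.

Lemma measurable_qker i : measurable_fun [set: E * E] (qker i).
Proof.
apply: measurable_funM; first exact: measurable_diff_coord.
rewrite /kern; under eq_fun do rewrite -powRN.
apply: (@measurableT_comp _ _ _ _ _ _ (@powR R ^~ _)) => //.
exact: measurable_dist2.
Qed.

Lemma qker_min_le i u :
  `|qker i u| * Num.min 1 (dist2 u) <= rker n alpha (dist2 u).
Proof.
rewrite /qker /rker mulrC normrM.
have m0 : 0 <= Num.min 1 (dist2 u) by rewrite le_min ler01 enorm_ge0.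
rewrite ler_wpM2l// [X in _ * X]ger0_norm ?invr_ge0 ?powR_ge0//.
by rewrite ler_wpM2r ?invr_ge0 ?powR_ge0// coord_le_enorm.
Qed.

Variable S : set E.
Hypotheses (mS : measurable S) (lamS : (lam S < +oo)%E).

(** Common majorant: the increment of a function supported in [S] vanishes unless one of the two
    points is in [S], and [|q_i| min(1, |z - y|)] is at most [rker]. *)
Definition wdom (u : E * E) : R :=
  (\1_S u.1 + \1_S u.2) * rker n alpha (dist2 u).

Let r_ge0 u : 0 <= rker n alpha (dist2 u).
Proof. by rewrite rker_ge0// enorm_ge0. Qed.

Let mr : measurable_fun [set: E * E] (fun u => rker n alpha (dist2 u)).
Proof. by apply: measurable_rker; exact: measurable_dist2. Qed.

Let m1 : measurable_fun [set: E * E] (fun u : E * E => \1_S u.1 : R).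
Proof.
by apply: (@measurableT_comp _ _ _ _ _ _ (\1_S : E -> R)) => //; exact: measurable_indic.
Qed.

Let m2 : measurable_fun [set: E * E] (fun u : E * E => \1_S u.2 : R).
Proof.
by apply: (@measurableT_comp _ _ _ _ _ _ (\1_S : E -> R)) => //; exact: measurable_indic.
Qed.

Lemma wdom_ge0 u : 0 <= wdom u.
Proof. by rewrite mulr_ge0// addr_ge0. Qed.

Lemma measurable_wdom : measurable_fun [set: E * E] wdom.
Proof. by apply: measurable_funM => //; exact: measurable_funD. Qed.

(** The two indicators call for opposite orders of integration: the variable not confined to [S]
    goes first. Symmetry of the distance makes the kernel bound available in both orders ([HC] and
    [HC']). *)
Lemma integral_wdom_lty : (\int[P]_u (wdom u)%:E < +oo)%E.
Proof.
have [C C0 HC] := rker_integral_bound n_gt0 alpha01 Hlam.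
have HC' (y : E) : (\int[lam]_z (rker n alpha (enorm ((y : 'rV[R]_n) - z)))%:E <= C%:E)%E.
  apply: le_trans (HC y); rewrite le_eqVlt; apply/orP; left; apply/eqP.
  by apply: eq_integral => z _; rewrite -enormN opprB.
have mry (y : E) : measurable_fun [set: E] (fun z => (rker n alpha (dist2 (y, z)))%:E).
  apply/measurable_EFinP; exact: (measurableT_comp mr).
have mrz (z : E) : measurable_fun [set: E] (fun y => (rker n alpha (dist2 (y, z)))%:E).
  apply/measurable_EFinP; exact: (measurableT_comp mr).
have fin (g : E -> \bar R) : measurable_fun setT g ->
   (forall y, (g y <= C%:E * (\1_S y)%:E)%E) -> (forall y, (0 <= g y)%E) ->
   (\int[lam]_y g y < +oo)%E.
  move=> mg gC g0; apply: (@le_lt_trans _ _ (\int[lam]_y (C%:E * (\1_S y)%:E))%E).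
    apply: ge0_le_integral => //.
    by apply: emeasurable_funM => //; exact/measurable_EFinP/measurable_indic.
  rewrite ge0_integralZl ?integral_indic ?setIT// ?lte_mul_pinfty ?lee_fin//.
  exact/measurable_EFinP/measurable_indic.
rewrite /wdom; under eq_integral do rewrite mulrDl EFinD.
have mh1 : measurable_fun [set: E * E] (fun u => (\1_S u.1 * rker n alpha (dist2 u))%:E).
  by apply/measurable_EFinP/measurable_funM.
have mh2 : measurable_fun [set: E * E] (fun u => (\1_S u.2 * rker n alpha (dist2 u))%:E).
  by apply/measurable_EFinP/measurable_funM.
have h10 u : (0 <= (\1_S u.1 * rker n alpha (dist2 u))%:E)%E.
  by rewrite lee_fin mulr_ge0.
have h20 u : (0 <= (\1_S u.2 * rker n alpha (dist2 u))%:E)%E.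
  by rewrite lee_fin mulr_ge0.
rewrite ge0_integralD//; apply: lte_add_pinfty.
- rewrite fubini_tonelli1//; apply: fin.
  + exact: measurable_fun_fubini_tonelli_F.
  + move=> y; rewrite /fubini_F /=; under eq_integral do rewrite EFinM.
    rewrite ge0_integralZl//= ?lee_fin//; last by move=> z _; rewrite lee_fin.
    by rewrite muleC lee_wpmul2r ?lee_fin//; exact: HC.
  + by move=> y; apply: integral_ge0.
- rewrite fubini_tonelli2//; apply: fin.
  + exact: measurable_fun_fubini_tonelli_G.
  + move=> z; rewrite /fubini_G /=; under eq_integral do rewrite EFinM.
    rewrite ge0_integralZl//= ?lee_fin//; last by move=> y _; rewrite lee_fin.
    by rewrite muleC lee_wpmul2r ?lee_fin//; exact: HC'.
  + by move=> y; apply: integral_ge0.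
Qed.

(** The marginal of [wdom] in [y] is at most [2 * C], as the indicators sum to at most 2, and it is
    integrable; this is what pairing with an L^p function requires. *)
Lemma wdom_integrable : P.-integrable [set: E * E] (EFin \o (fun u => f u.1 * wdom u)).
Proof.
have [C C0 HC] := rker_integral_bound n_gt0 alpha01 Hlam.
have mw := measurable_wdom.
have mfw : measurable_fun [set: E * E] (fun u : E * E => f u.1 * wdom u).
  by apply: measurable_funM => //; exact: (measurableT_comp mf).
apply/integrable12ltyP; first exact/measurable_EFinP.
have mwy (y : E) : measurable_fun [set: E] (fun z => (wdom (y, z))%:E).
  apply/measurable_EFinP; exact: (measurableT_comp mw).
pose G y := (\int[lam]_z (wdom (y, z))%:E)%E.
rewrite [X in (X < _)%E](_ : _ = \int[lam]_x (`|f x|%:E * G x))%E; last first.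
  apply: eq_integral => y _; under eq_integral do
    rewrite /= normrM (ger0_norm (wdom_ge0 _)) EFinM.
  by rewrite ge0_integralZl// => z _; rewrite lee_fin wdom_ge0.
have wdom0 u : (0 <= (wdom u)%:E)%E by rewrite lee_fin wdom_ge0.
have mw' : measurable_fun [set: E * E] (fun u => (wdom u)%:E) by exact/measurable_EFinP.
apply: (@Lp_mul_bounded_integrable _ _ _ lam f G (2 * C)) p_gt1 Lf => //.
- exact: (measurable_fun_fubini_tonelli_F (fun u => (wdom u)%:E)).
- by rewrite mulr_ge0.
- by move=> y; apply: integral_ge0.
- move=> y; apply: (@le_trans _ _ (\int[lam]_z (2%:E * (rker n alpha (dist2 (y, z)))%:E))%E).
    apply: ge0_le_integral => //.
    + apply: emeasurable_funM => //; apply/measurable_EFinP.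
      exact: (measurableT_comp mr).
    + move=> z _; rewrite -EFinM lee_fin ler_wpM2r//.
      by rewrite (_ : 2 = 1 + 1)// lerD// indicE; case: (_ \in _).
  rewrite ge0_integralZl//; last 2 first.
  + by apply/measurable_EFinP; exact: (measurableT_comp mr).
  + by move=> z _; rewrite lee_fin.
  by rewrite EFinM lee_wpmul2l//; exact: HC.
- have := integral_wdom_lty; rewrite fubini_tonelli1//.
Qed.

Lemma weighted_le (i : 'I_n) (A h : R) (u : E * E) :
  `|h| <= A * ((\1_S u.1 + \1_S u.2) * Num.min 1 (dist2 u)) ->
  `|f u.1 * (qker i u * h)| <= `|A * (f u.1 * wdom u)|.
Proof.
move=> Hh; rewrite (mulrCA A) (normrM (f u.1)) (normrM (f u.1)).
rewrite ler_wpM2l// [X in X <= _]normrM (normrM A) (normrM (_ + _)).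
have s0 : 0 <= \1_S u.1 + \1_S u.2 :> R by rewrite addr_ge0.
apply: (@le_trans _ _ (`|qker i u| * (`|A| * ((\1_S u.1 + \1_S u.2) * Num.min 1 (dist2 u))))).
  rewrite ler_wpM2l//; apply: le_trans Hh _; rewrite ler_wpM2r ?ler_norm//.
  by rewrite mulr_ge0// le_min ler01 enorm_ge0.
rewrite [leLHS]mulrCA ler_wpM2l// (ger0_norm s0) mulrCA ler_wpM2l//.
by rewrite (le_trans (qker_min_le i u))// ler_norm.
Qed.

Lemma weighted_integrable (i : 'I_n) (A : R) (H : E * E -> R) :
  measurable_fun [set: E * E] H ->
  (forall u, `|H u| <= A * ((\1_S u.1 + \1_S u.2) * Num.min 1 (dist2 u))) ->
  P.-integrable [set: E * E] (EFin \o (fun u => f u.1 * (qker i u * H u))).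
Proof.
move=> mH HH.
have := integrableZl measurableT A wdom_integrable; apply: le_integrable => //.
  apply/measurable_EFinP/measurable_funM; first exact: (measurableT_comp mf).
  by apply: measurable_funM => //; exact: measurable_qker.
by move=> u _; rewrite /= lee_fin; exact: weighted_le.
Qed.

End domination.

(** * The defect functional *)

Section defect.
Variables (R : realType) (n : nat) (alpha : R).
Local Notation E := (Rn R n).
Hypotheses (n_gt0 : (0 < n)%N) (alpha01 : 0 < alpha < 1).
Variable lam : {sigma_finite_measure set E -> \bar R}.
Hypothesis Hlam : is_lebesgue_Rn lam.
Local Notation P := (lam \x lam)%E.
Variables (p : \bar R) (f : E -> R).
Hypotheses (p_gt1 : (1 < p)%E) (mf : measurable_fun [set: E] f).
Hypothesis Lf : (Lnorm lam p (EFin \o f) < +oo)%E.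

Definition dens (i : 'I_n) (g : E -> R) (u : E * E) : R :=
  f u.1 * (qker alpha i u * (g u.2 - g u.1)).

Definition weak (i : 'I_n) (g : E -> R) : R := Rintegral P setT (dens i g).

Variables (mup mun : {finite_measure set E -> \bar R}).

(* The amount by which the pair (f, D^alpha f) fails the duality formula against
   the field g e_i, written as a double integral over R^n x R^n. *)
Definition defect (i : 'I_n) (g : E -> R) : R :=
  mu_na n alpha * weak i g + charge_integral mup mun setT g.

Lemma charge_integral0 (D : set E) (m1 m2 : {finite_measure set E -> \bar R}) :
  charge_integral m1 m2 D (fun=> 0) = 0.
Proof. by rewrite /charge_integral /Rintegral !integral0 subrr. Qed.

Section tame.
Variable S : set E.
Hypotheses (mS : measurable S) (lamS : (lam S < +oo)%E).

(** The sup bound, the Lipschitz bound and the support of [g] enter integrability of [dens] only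
    through this estimate on increments. *)
Definition tame (A : R) (g : E -> R) : Prop := forall y z : E,
  `|g z - g y| <= A * ((\1_S y + \1_S z) * Num.min 1 (dist2 (y, z))).

Lemma dens_integrable i A g : measurable_fun [set: E] g -> tame A g ->
  P.-integrable [set: E * E] (EFin \o dens i g).
Proof.
move=> mg tg.
apply: (@weighted_integrable _ _ _ n_gt0 alpha01 _ Hlam _ _ p_gt1 mf Lf S mS lamS i A
   (fun u => g u.2 - g u.1)); last by move=> [y z]; exact: tg.
by apply: measurable_funB; exact: (measurableT_comp mg).
Qed.

(** The constant [L] serves for points at distance at most 1, and [2 * M] for points further
    apart. *)
Lemma tame_lipschitz (L M : R) (g : E -> R) :
  (forall x y : E, `|g x - g y| <= L * enorm ((x : 'rV[R]_n) - y)) ->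
  (forall x, `|g x| <= M) -> (forall x, g x != 0 -> S x) ->
  tame (Num.max L (2 * M)) g.
Proof.
move=> gL gM gS y z.
have M0 : 0 <= M by apply: le_trans (gM y).
have d0 : 0 <= dist2 (y, z) by exact: enorm_ge0.
have m0 : 0 <= Num.min 1 (dist2 (y, z)) by rewrite le_min ler01.
have H : `|g z - g y| <= Num.max L (2 * M) * Num.min 1 (dist2 (y, z)).
  rewrite /Num.min; case: ifPn => _; last first.
    by rewrite (le_trans (gL z y))// ler_wpM2r// le_max lexx.
  apply: le_trans (ler_normB _ _) _.
  by rewrite mulr1 le_max mulr_natl mulr2n lerD ?orbT.
have g0 x : x \notin S -> g x = 0.
  by move=> xS; apply/eqP; apply: contraNT xS => /gS Sx; exact/mem_set.
have K0 : 0 <= Num.max L (2 * M) by rewrite le_max mulr_ge0 ?orbT.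
have [Sy|Sy] := boolP (y \in S).
  apply: le_trans H _; rewrite ler_wpM2l// -[leLHS]mul1r ler_wpM2r//.
  by rewrite !indicE Sy lerDl.
have [Sz|Sz] := boolP (z \in S).
  apply: le_trans H _; rewrite ler_wpM2l// -[leLHS]mul1r ler_wpM2r//.
  by rewrite !indicE Sz lerDr.
by rewrite !g0// subrr normr0 !indicE (negbTE Sy) (negbTE Sz) addr0 mul0r mulr0.
Qed.

End tame.

(** * Superpositions pass through the defect *)

Section superposition.
Context d (Y : measurableType d) (nu : {sigma_finite_measure set Y -> \bar R}).
Variable psi : Y * E -> R.
Hypothesis mpsi : measurable_fun [set: Y * E] psi.
Variables (S : set E) (A B : R).
Hypotheses (mS : measurable S) (lamS : (lam S < +oo)%E).
Hypothesis psiA : forall y z : E,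
  (\int[nu]_s `|psi (s, z) - psi (s, y)|%:E <=
   (A * ((\1_S y + \1_S z) * Num.min 1 (dist2 (y, z))))%:E)%E.
Hypothesis psiB : forall y : E, (\int[nu]_s `|psi (s, y)|%:E <= B%:E)%E.

Let integrable_psi (y : E) : nu.-integrable setT (EFin \o (fun s => psi (s, y))).
Proof.
apply/integrableP; split; first exact/measurable_EFinP/(measurableT_comp mpsi).
exact: le_lt_trans (psiB y) (ltry _).
Qed.

Let F i (v : Y * (E * E)) : R := dens i (fun y => psi (v.1, y)) v.2.

Let mpsi2 : measurable_fun [set: Y * (E * E)] (fun v : Y * (E * E) => psi (v.1, v.2.2)).
Proof.
apply: (measurableT_comp mpsi); apply/measurable_fun_pairP; split => /=.
  exact: measurable_fst.
exact: (measurableT_comp measurable_snd measurable_snd).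
Qed.

Let mpsi1 : measurable_fun [set: Y * (E * E)] (fun v : Y * (E * E) => psi (v.1, v.2.1)).
Proof.
apply: (measurableT_comp mpsi); apply/measurable_fun_pairP; split => /=.
  exact: measurable_fst.
exact: (measurableT_comp measurable_fst measurable_snd).
Qed.

Let mF i : measurable_fun [set: Y * (E * E)] (F i).
Proof.
apply: measurable_funM.
  exact: (measurableT_comp mf (measurableT_comp measurable_fst measurable_snd)).
apply: measurable_funM.
  exact: (measurableT_comp (measurable_qker alpha i) measurable_snd).
exact: measurable_funB.
Qed.

(** Tonelli with the parameter [s] innermost: [psiA] bounds that integral by [|f q_i|] times the
    weight, which [A * (f * wdom)] dominates. *)
Lemma superposition_dens_integrable i :
  (nu \x product_sf lam lam)%E.-integrable setT
    (EFin \o (fun v : Y * (E * E) => dens i (fun y => psi (v.1, y)) v.2)).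
Proof.
have mF' : measurable_fun setT (EFin \o F i) by apply/measurable_EFinP; exact: mF.
apply: (integrable21ltyP nu (product_sf lam lam) mF').2.
have iw := @wdom_integrable _ _ _ n_gt0 alpha01 _ Hlam _ _ p_gt1 mf Lf S mS lamS.
have /integrableP[_] := integrableZl measurableT A iw.
apply: le_lt_trans; apply: ge0_le_integral => //.
- by move=> u _; exact: integral_ge0.
- apply: (measurable_fun_fubini_tonelli_G (m1 := nu) (abse \o (EFin \o F i))) => //.
    exact: measurableT_comp.
  by move=> v; exact: abse_ge0.
- apply: (@measurableT_comp _ _ _ _ _ _ abse) => //.
  exact: measurable_int (integrableZl measurableT A iw).
- move=> [y z] _ /=.
  under eq_integral do rewrite /F /dens /= mulrA normrM EFinM.
  rewrite ge0_integralZl//; last first.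
    apply/measurable_EFinP/measurableT_comp => //; apply: measurable_funB;
    exact: (measurableT_comp mpsi).
  pose X := A * ((\1_S y + \1_S z) * Num.min 1 (dist2 (y, z))).
  (* No sign is assumed for [A]; the product is nonnegative because it bounds the integral in
     [psiA]. *)
  have X0 : 0 <= X.
    rewrite -lee_fin; apply: le_trans (psiA y z).
    by apply: integral_ge0 => s _; rewrite lee_fin.
  apply: (@le_trans _ _ (`|f y * qker alpha i (y, z)|%:E * X%:E)%E).
    by rewrite lee_wpmul2l// lee_fin.
  rewrite -EFinM lee_fin -[X in _ * X <= _](ger0_norm X0) -normrM -mulrA.
  by apply: (@weighted_le _ _ _ f S i A X (y, z)); rewrite ger0_norm.
Qed.

Let psi_charge (m : {finite_measure set E -> \bar R}) :
  nu.-integrable setT (EFin \o (fun s => Rintegral m setT (fun y => psi (s, y)))) /\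
  Rintegral nu setT (fun s => Rintegral m setT (fun y => psi (s, y))) =
  Rintegral m setT (fun y => Rintegral nu setT (fun s => psi (s, y))).
Proof.
have i1 : (nu \x m)%E.-integrable setT (EFin \o psi).
  have mpsi' : measurable_fun setT (EFin \o psi) by exact/measurable_EFinP.
  apply: (integrable21ltyP nu m mpsi').2.
  apply: (@le_lt_trans _ _ (\int[m]_y B%:E)%E).
    apply: ge0_le_integral => //.
    - by move=> u _; exact: integral_ge0.
    - apply: (measurable_fun_fubini_tonelli_G (m1 := nu) (abse \o (EFin \o psi))) => //.
        exact: measurableT_comp.
      by move=> v; exact: abse_ge0.
    - by move=> y _; exact: psiB.
  rewrite integral_cst//.
  have : (B%:E * m [set: E])%E \is a fin_num.
    by rewrite fin_numM// fin_num_measure.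
  by case/fin_numPlt/andP.
have [? ->] := Rintegral_fubini i1; split => //.
by rewrite Rintegral_fubini_swap.
Qed.

Lemma superposition i :
  nu.-integrable setT (EFin \o (fun s => defect i (fun y => psi (s, y)))) /\
  Rintegral nu setT (fun s => defect i (fun y => psi (s, y))) =
  defect i (fun y => Rintegral nu setT (fun s => psi (s, y))).
Proof.
have [iW EW] := Rintegral_fubini (superposition_dens_integrable i).
have [i1 E1] := psi_charge mup; have [i2 E2] := psi_charge mun.
have iW' := integrableZl measurableT (mu_na n alpha) iW.
have iC := integrableB measurableT i1 i2.
split; first exact: (integrableD measurableT iW' iC).
rewrite /defect RintegralD//; congr (_ + _).
  rewrite RintegralZl//; congr (_ * _); rewrite EW.
  rewrite -Rintegral_fubini_swap ?superposition_dens_integrable//.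
  apply: eq_Rintegral => -[y z] _; rewrite /dens /=.
  have iB := integrableB measurableT (integrable_psi z) (integrable_psi y).
  rewrite -RintegralB// -RintegralZl//= -RintegralZl//.
  exact: (integrableZl measurableT _ iB).
by rewrite /charge_integral RintegralB// E1 E2.
Qed.

End superposition.
End defect.

(** * Smooth test fields *)

(** The shape in which [fdiv], [fgrad] and [fdivNL] occur: an outer weight, the constant [mu_na],
    and an inner integral. *)
Lemma Rintegral_weighted_fubini_scaled d1 d2 (T1 : measurableType d1)
    (T2 : measurableType d2) (R : realType)
    (m1 : {sigma_finite_measure set T1 -> \bar R})
    (m2 : {sigma_finite_measure set T2 -> \bar R})
    (c : R) (g : T1 -> R) (F : T1 * T2 -> R) :
  measurable_fun [set: T1] g -> measurable_fun [set: T1 * T2] F ->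
  (m1 \x m2)%E.-integrable [set: T1 * T2] (EFin \o (fun u => g u.1 * F u)) ->
  m1.-integrable [set: T1]
    (EFin \o (fun x => g x * (c * Rintegral m2 [set: T2] (fun y => F (x, y))))) /\
  Rintegral m1 [set: T1] (fun x => g x * (c * Rintegral m2 [set: T2] (fun y => F (x, y))))
  = c * Rintegral (m1 \x m2)%E [set: T1 * T2] (fun u => g u.1 * F u).
Proof.
move=> mg mF iF; have [i1 <-] := Rintegral_weighted_fubini mg mF iF.
rewrite -RintegralZl//; under eq_fun do rewrite mulrCA; split => //.
exact: (integrableZl measurableT c i1).
Qed.

Lemma Rintegral_dominated_cvg d (T : measurableType d) (R : realType)
    (mu : {measure set T -> \bar R}) (f_ : nat -> T -> R) (f g : T -> R) :
  (forall k, measurable_fun [set: T] (f_ k)) -> measurable_fun [set: T] f ->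
  (forall x, f_ k x @[k --> \oo] --> f x) ->
  mu.-integrable [set: T] (EFin \o g) -> (forall k x, `|f_ k x| <= g x) ->
  Rintegral mu [set: T] (f_ k) @[k --> \oo] --> Rintegral mu [set: T] f.
Proof.
move=> mf_ mf cf ig fg.
have [i1 _ c1] : [/\ mu.-integrable setT (EFin \o f),
    [sequence \int[mu]_x `|(f_ k x)%:E - (f x)%:E|]_k @ \oo --> 0 &
    [sequence \int[mu]_x (f_ k x)%:E]_k @ \oo --> \int[mu]_x (f x)%:E]%E.
  apply: (@dominated_convergence _ _ _ mu setT measurableT _ _ (EFin \o g)) => //.
  - by move=> k; exact/measurable_EFinP.
  - exact/measurable_EFinP.
  - by apply: aeW => x _; apply: cvg_EFin; [exact: nearW|exact: cf].
  - by apply: aeW => x k _; rewrite lee_fin.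
apply: fine_cvg; rewrite fineK//; exact: integrable_fin_num.
Qed.

Section test_fields.
Variables (R : realType) (n : nat) (alpha : R).
Local Notation E := (Rn R n).
Hypotheses (n_gt0 : (0 < n)%N) (alpha01 : 0 < alpha < 1).
Variable lam : {sigma_finite_measure set E -> \bar R}.
Hypothesis Hlam : is_lebesgue_Rn lam.
Local Notation P := (lam \x lam)%E.
Variables (p : \bar R) (f : E -> R).
Hypotheses (p_gt1 : (1 < p)%E) (mf : measurable_fun [set: E] f).
Hypothesis Lf : (Lnorm lam p (EFin \o f) < +oo)%E.
Variables (mup mun : 'I_n -> {finite_measure set E -> \bar R}).
Hypothesis HD : is_Dalpha lam alpha f mup mun.

Lemma lipschitz_continuous (L : R) (g : 'rV[R]_n -> R) :
  (forall x y, `|g x - g y| <= L * enorm (x - y)) -> continuous g.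
Proof.
move=> gL x; apply: (@cvgrPdist_le _ _ _ (nbhs x) _ g (g x)).2 => e e0.
pose K := (`|L| * n%:R + 1); have K0 : 0 < K by rewrite ltr_wpDl// mulr_ge0.
have eK : 0 < e / K by rewrite divr_gt0.
have : \forall y \near x, `|x - y| < e / K by apply/nbhs_normP; exists (e / K).
apply: filterS => y /ltW xy; apply: le_trans (gL x y) _.
apply: (@le_trans _ _ (`|L| * (n%:R * `|x - y|))).
  apply: (@le_trans _ _ (`|L| * enorm (x - y))).
    by rewrite ler_wpM2r ?enorm_ge0 ?ler_norm.
  rewrite ler_wpM2l//; apply: le_trans (enorm_le_sum _) _.
  rewrite mulr_natl -[X in _ *+ X](card_ord n) -sumr_const.
  by apply: ler_sum => i _; exact: le_coord_mx_norm.
rewrite mulrA; apply: (@le_trans _ _ (K * `|x - y|)).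
  by rewrite ler_wpM2r// lerDl.
by rewrite mulrC -ler_pdivlMr.
Qed.

Lemma defect_test (i : 'I_n) (g : 'rV[R]_n -> R) (L M K : R) :
  smooth g -> (forall x y, `|g x - g y| <= L * enorm (x - y)) ->
  (forall x, `|g x| <= K) -> (forall x, g x != 0 -> forall j, `|x ord0 j| < M) ->
  defect alpha lam f (mup i) (mun i) i g = 0.
Proof.
move=> sg gL gK gM.
have mg : measurable_fun [set: E] (g : E -> R).
  by apply: continuous_measurable_Rn; exact: lipschitz_continuous gL.
pose S : set E := cube 0 `|M|.
have mS : measurable S by exact: measurable_box.
have lamS : (lam S < +oo)%E by rewrite /S (lebesgue_cube Hlam)// ltry.
have gS (x : E) : g x != 0 -> S x.
  move=> /gM H j; rewrite !mxE !add0r.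
  have := lt_le_trans (H j) (ler_norm M).
  by rewrite ltr_norml => /andP[/ltW -> ->].
have tg := tame_lipschitz gL gK gS.
have iW := dens_integrable n_gt0 alpha01 Hlam p_gt1 mf Lf mS lamS i mg tg.
pose phi (x : 'rV[R]_n) : 'rV[R]_n := \row_j (if j == i then g x else 0).
have Cphi : Ccinf phi.
  split=> [j|].
    have [->|ji] := eqVneq j i.
      by rewrite (_ : (fun x => _) = g)//; apply/funext => x; rewrite mxE eqxx.
    rewrite (_ : (fun x => _) = (fun=> 0)); last first.
      by apply/funext => x; rewrite mxE (negbTE ji).
    apply: smooth_alg_smooth; exact: smooth_alg_cst.
  apply: (@compact_support_bounded _ _ _ M) => x px j; apply/ltW/gM.
  apply: contra px => /eqP gx0; apply/eqP/rowP => k.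
  by rewrite !mxE gx0 if_same.
have := HD Cphi.
rewrite (bigD1 i)//= big1 ?addr0; last first.
  move=> j ji; rewrite (_ : (fun x => _) = (fun=> 0)) ?charge_integral0//.
  by apply/funext => x; rewrite mxE (negbTE ji).
rewrite (_ : (fun x => phi x ord0 i) = g); last first.
  by apply/funext => x; rewrite mxE eqxx.
rewrite /defect /weak => /eqP; rewrite -subr_eq0 opprK => /eqP <-; congr (_ + _).
have mF : measurable_fun [set: E * E] (fun u => qker alpha i u * (g u.2 - g u.1)).
  apply: measurable_funM; first exact: measurable_qker.
  by apply: measurable_funB; exact: (measurableT_comp mg).
have [_ <-] := Rintegral_weighted_fubini_scaled (mu_na n alpha) mf mF iW.
apply: eq_Rintegral => y _; congr (_ * (_ * _)); apply: eq_Rintegral => z _.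
rewrite /qker /= /dotv (bigD1 i)//= big1 ?addr0; last first.
  by move=> j ji; rewrite !mxE (negbTE ji) subrr mulr0.
by rewrite !mxE eqxx mulrAC.
Qed.

End test_fields.

(** * Mollification *)

Section bump_integral.
Variables (R : realType) (n : nat).
Local Notation E := (Rn R n).
Variable lam : {measure set E -> \bar R}.
Hypothesis Hlam : is_lebesgue_Rn lam.

Lemma Rintegral_translation (x : 'rV[R]_n) (h : E -> R) :
  measurable_fun [set: E] h ->
  lam.-integrable [set: E] (EFin \o (fun z : E => h ((z : 'rV[R]_n) + x))) ->
  Rintegral lam [set: E] h = Rintegral lam [set: E] (fun z : E => h ((z : 'rV[R]_n) + x)).
Proof.
move=> mh ih; have mT := @measurable_translation R n x.
rewrite /Rintegral; congr fine.
have mh' : measurable_fun [set: E] (EFin \o h) by exact/measurable_EFinP.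
have := @integral_pushforward _ _ _ _ R _ mT lam setT (EFin \o h) mh' ih measurableT.
rewrite preimage_setT => <-.
by apply: eq_measure_integral => A mA _; rewrite /= /pushforward lebesgue_translation.
Qed.

Lemma continuous_bump e : continuous (@bumpf R n e).
Proof.
move=> u.
have -> : @bumpf R n e = (fun x => bumpf e (0 - (- x))).
  by apply/funext => x; rewrite sub0r opprK.
apply: (@continuous_comp _ _ _ (fun x : 'rV[R]_n => - x) (fun x => bumpf e (0 - x))).
  by apply: continuousN; exact: cvg_id.
exact: (continuous_smooth_alg (smooth_alg_bump e 0)).
Qed.

Lemma measurable_bump e : measurable_fun [set: E] (bumpf e : E -> R).
Proof. by apply: continuous_measurable_Rn; exact: continuous_bump. Qed.

Lemma integrable_indic_finite (A : set E) : measurable A -> (lam A < +oo)%E ->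
  lam.-integrable [set: E] (EFin \o (\1_A : E -> R)).
Proof.
move=> mA fA; apply/integrableP; split; first exact/measurable_EFinP/measurable_indic.
by under eq_integral do rewrite /= ger0_norm//; rewrite integral_indic// setIT.
Qed.

Lemma integrable_bump e : 0 < e -> lam.-integrable [set: E] (EFin \o (bumpf e : E -> R)).
Proof.
move=> e0; have lc : (lam (cube 0 e) < +oo)%E by rewrite (lebesgue_cube Hlam) ?ltry// ltW.
have := integrable_indic_finite (measurable_box _ _) lc.
apply: le_integrable => //; first by apply/measurable_EFinP; exact: measurable_bump.
move=> u _; rewrite /= lee_fin ger0_norm ?bump_ge0// [leRHS]ger0_norm//.
rewrite indicE; have [uc|uc] := boolP (u \in cube 0 e); first exact: bump_le1.
rewrite leNgt; apply: contra uc => /(bump_gt0 _ e0) H; rewrite inE => j.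
by rewrite !mxE !add0r; have := H j; rewrite ltr_norml => /andP[/ltW -> ->].
Qed.

(** A zero integral would make the bump vanish almost everywhere, yet it is positive on the cube of
    half-side [e / 2], of volume [e^n]. *)
Lemma Rintegral_bump_gt0 e : 0 < e -> 0 < Rintegral lam [set: E] (bumpf e).
Proof.
move=> e0; rewrite lt0r; apply/andP; split; last first.
  by apply: Rintegral_ge0 => u _; exact: bump_ge0.
apply/negP => /eqP; rewrite /Rintegral => i0.
have : (\int[lam]_u `|(bumpf e u)%:E| = 0)%E.
  under eq_integral do rewrite /= ger0_norm ?bump_ge0//.
  by rewrite -[LHS]fineK ?i0//; exact: (integrable_fin_num measurableT (integrable_bump e0)).
move/(ae_eq_integral_abs lam measurableT ((measurable_EFinP _ _).2 (measurable_bump e))).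
move=> [N [mN N0 HN]].
have : (lam (cube 0 (e / 2)) <= lam N)%E.
  apply: le_measure; rewrite ?inE//; first exact: measurable_box.
  move=> u Hu; apply: HN => /= /(_ I) [] /eqP; rewrite gt_eqF//.
  apply/(bump_gt0 _ e0) => j; have := Hu j; rewrite !mxE !add0r => /andP[h1 h2].
  by rewrite ltr_norml; apply/andP; split; lra.
rewrite N0 (lebesgue_cube Hlam); last by rewrite divr_ge0 ?ltW.
by rewrite lee_fin leNgt exprn_gt0//; rewrite mulrC divfK ?pnatr_eq0.
Qed.

Lemma bump_dist_le e (w x y : 'rV[R]_n) : 0 < e ->
  `|bumpf e (w - x) - bumpf e (w - y)| <= 4 / e * n%:R * enorm (x - y).
Proof.
move=> e0; apply: le_trans (bump_lipschitz _ _ e0) _.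
rewrite -[leRHS]mulrA ler_wpM2l ?divr_ge0 ?(ltW e0)//.
rewrite mulr_natl -[X in _ *+ X](card_ord n) -sumr_const.
apply: ler_sum => j _; apply: le_trans (coord_le_enorm (x - y) j).
by rewrite !mxE distrC (_ : _ - _ = x ord0 j - y ord0 j)//; ring.
Qed.

End bump_integral.

Section mollification.
Variables (R : realType) (n : nat) (alpha : R).
Local Notation E := (Rn R n).
Hypotheses (n_gt0 : (0 < n)%N) (alpha01 : 0 < alpha < 1).
Variable lam : {sigma_finite_measure set E -> \bar R}.
Hypothesis Hlam : is_lebesgue_Rn lam.
Local Notation P := (lam \x lam)%E.
Variables (p : \bar R) (f : E -> R).
Hypotheses (p_gt1 : (1 < p)%E) (mf : measurable_fun [set: E] f).
Hypothesis Lf : (Lnorm lam p (EFin \o f) < +oo)%E.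
Variables (mup mun : 'I_n -> {finite_measure set E -> \bar R}).
Hypothesis HD : is_Dalpha lam alpha f mup mun.
Variables (g : 'rV[R]_n -> R) (L K M : R).
Hypotheses (L0 : 0 <= L) (K0 : 0 <= K) (M0 : 0 <= M).
Hypothesis gL : forall x y, `|g x - g y| <= L * enorm (x - y).
Hypothesis gK : forall x, `|g x| <= K.
Hypothesis gM : forall x, g x != 0 -> forall j, `|x ord0 j| <= M.

Let mg : measurable_fun [set: E] (g : E -> R).
Proof. by apply: continuous_measurable_Rn; exact: lipschitz_continuous gL. Qed.

Let c e := Rintegral lam [set: E] (bumpf e : E -> R).

(** Written with the parameter [w] in [g] and the variable [x] in the bump, so that it superposes
    smooth functions of [x]. The substitution [w = z + x] in [mollE] turns it into an average of
    translates of [g], from which the Lipschitz and sup bounds are read off. *)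
Definition moll (e : R) (x : 'rV[R]_n) : R :=
  Rintegral lam [set: E] (fun w : E => g w / c e * bumpf e ((w : 'rV[R]_n) - x)).

Section fixed_scale.
Variable e : R.
Hypothesis e0 : 0 < e.

Let c0 : 0 < c e. Proof. exact: Rintegral_bump_gt0. Qed.

Let cV0 : 0 <= (c e)^-1. Proof. by rewrite invr_ge0 ltW. Qed.

Let psi (v : E * E) : R := g v.1 / c e * bumpf e ((v.1 : 'rV[R]_n) - v.2).

Let mpsi : measurable_fun [set: E * E] psi.
Proof.
apply: measurable_funM.
  by apply: measurable_funM => //; exact: (measurableT_comp mg).
apply: measurable_prod => j _.
have md : measurable_fun [set: E * E] (fun v : E * E => ((v.1 : 'rV[R]_n) - v.2) ord0 j).
  under eq_fun do rewrite !mxE; apply: measurable_funB;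
  exact: (measurableT_comp (measurable_coord j)).
have mfl : measurable_fun [set: R] (@flat R 0).
  by apply: continuous_measurable_fun; exact: continuous_flat.
apply: measurable_funM.
  apply: (measurableT_comp mfl); apply: measurable_funD => //.
  exact: measurable_funM.
apply: (measurableT_comp mfl); apply: measurable_funB => //.
exact: measurable_funM.
Qed.

(** [S] contains the supports in the variable [x], while [T] contains the support of [g] in the
    parameter [w]. *)
Let S : set E := cube 0 (M + e).
Let T : set E := cube 0 (M + 1).

Let in_cube (x : E) (r : R) : (forall j, `|x ord0 j : R| < r) -> cube 0 r x.
Proof.
move=> H j; rewrite !mxE !add0r.
by have := H j; rewrite ltr_norml => /andP[/ltW -> ->].
Qed.

Let psi_supp (w x : E) : psi (w, x) != 0 -> forall j, `|x ord0 j : R| < M + e.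
Proof.
rewrite /psi /= mulf_eq0 negb_or mulf_eq0 negb_or => /andP[/andP[gw _] bw] j.
have : 0 < bumpf e ((w : 'rV[R]_n) - x) by rewrite lt0r bw bump_ge0.
move/(bump_gt0 _ e0)/(_ j); rewrite !mxE => h1.
have h2 := gM gw j.
rewrite -(subrK (w ord0 j) (x ord0 j)) addrC.
by apply: le_lt_trans (ler_normD _ _) _; rewrite ler_ltD// distrC.
Qed.

Let psi_lip (w x y : E) :
  `|psi (w, x) - psi (w, y)| <= `|g w / c e| * (4 / e * n%:R) * enorm ((x : 'rV[R]_n) - y).
Proof.
by rewrite /psi /= -mulrBr normrM -mulrA ler_wpM2l//; exact: bump_dist_le.
Qed.

Let psi_bnd (w x : E) : `|psi (w, x)| <= `|g w / c e|.
Proof.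
rewrite /psi /= normrM -[leRHS]mulr1 ler_wpM2l//.
by rewrite ger0_norm ?bump_ge0// bump_le1.
Qed.

Let gcT (w : E) : `|g w / c e| <= K / c e * \1_T w.
Proof.
have [->|gw] := eqVneq (g w) 0; first by rewrite mul0r normr0 !mulr_ge0.
have wT : w \in T.
  by rewrite inE; apply: in_cube => j; rewrite (le_lt_trans (gM gw j))// ltrDl.
by rewrite indicE wT mulr1 normrM (ger0_norm cV0) ler_wpM2r.
Qed.

Let mS : measurable S. Proof. exact: measurable_box. Qed.
Let mT : measurable T. Proof. exact: measurable_box. Qed.
Let lamS : (lam S < +oo)%E.
Proof. by rewrite /S (lebesgue_cube Hlam) ?ltry// addr_ge0// ltW. Qed.
Let lamT : (lam T < +oo)%E.
Proof. by rewrite /T (lebesgue_cube Hlam) ?ltry// addr_ge0. Qed.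

Let integral_le_T (h : E -> R) (X : R) : measurable_fun [set: E] h -> 0 <= X ->
  (forall w, 0 <= h w) -> (forall w, h w <= K / c e * \1_T w * X) ->
  (\int[lam]_w (h w)%:E <= (K / c e * fine (lam T) * X)%:E)%E.
Proof.
move=> mh X0 h0 hT.
have KX : 0 <= K / c e * X by rewrite !mulr_ge0.
apply: (@le_trans _ _ (\int[lam]_w ((K / c e * X) * \1_T w)%:E)%E).
  apply: ge0_le_integral => //.
  - by move=> w _; rewrite lee_fin.
  - exact/measurable_EFinP.
  - by apply/measurable_EFinP/measurable_funM => //; exact: measurable_indic.
  - by move=> w _; rewrite lee_fin mulrAC.
rewrite integral_scaled_indic// -[X in (_ * X <= _)%E]fineK ?ge0_fin_numE//.
by rewrite -EFinM lee_fin mulrAC.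
Qed.

Lemma defect_moll i : defect alpha lam f (mup i) (mun i) i (moll e) = 0.
Proof.
have psi0 (w : E) : defect alpha lam f (mup i) (mun i) i (fun x => psi (w, x)) = 0.
  apply: (@defect_test R n alpha n_gt0 alpha01 lam Hlam p f p_gt1 mf Lf mup mun HD i _
    (`|g w / c e| * (4 / e * n%:R)) (M + e) `|g w / c e|).
  - apply: smooth_alg_smooth.
    exact: (smooth_alg_mul (@smooth_alg_cst R n (g w / c e)) (smooth_alg_bump e w)).
  - exact: psi_lip.
  - exact: psi_bnd.
  - exact: psi_supp.
have mpx (x : E) : measurable_fun [set: E] (fun w => psi (w, x)).
  exact: (measurableT_comp mpsi).
(* With [|g w / c e|] factored out, [tame_lipschitz] leaves the larger of the bump's Lipschitz
   constant and twice its bound 1. *)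
pose Q := Num.max (4 / e * n%:R) 2.
have Q0 : 0 <= Q by rewrite le_max ler0n orbT.
have X0 (y z : E) : 0 <= (\1_S y + \1_S z) * Num.min 1 (dist2 (y, z)) :> R.
  by rewrite mulr_ge0 ?addr_ge0// le_min ler01 enorm_ge0.
have hA (y z : E) : (\int[lam]_w `|psi (w, z) - psi (w, y)|%:E <=
   (K / c e * fine (lam T) * Q * ((\1_S y + \1_S z) * Num.min 1 (dist2 (y, z))))%:E)%E.
  rewrite -[X in (_ <= X%:E)%E]mulrA; apply: integral_le_T => //.
  - by apply: measurableT_comp => //; exact: measurable_funB.
  - exact: mulr_ge0.
  - move=> w; have := @tame_lipschitz _ _ S _ `|g w / c e| (fun x => psi (w, x))
      (psi_lip w) (psi_bnd w) (fun x px => in_cube (psi_supp px)) y z.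
    move/le_trans; apply; rewrite mulrA ler_wpM2r//.
    by rewrite (mulrC 2) -maxr_pMr// ler_wpM2r.
have hB (y : E) : (\int[lam]_w `|psi (w, y)|%:E <= (K / c e * fine (lam T))%:E)%E.
  rewrite -[X in (_ <= X%:E)%E]mulr1; apply: integral_le_T => //.
  - exact: measurableT_comp.
  - by move=> w; rewrite mulr1; apply: le_trans (psi_bnd w y) _.
have [_ <-] := superposition n_gt0 alpha01 Hlam p_gt1 mf Lf (mup i) (mun i) mpsi mS lamS hA hB i.
by under eq_fun do rewrite psi0; rewrite /Rintegral integral0.
Qed.

Let b (z : E) : R := bumpf e z / c e.

Let b_ge0 z : 0 <= b z. Proof. by rewrite mulr_ge0// bump_ge0. Qed.

Let mb : measurable_fun [set: E] b.
Proof. by apply: measurable_funM => //; exact: measurable_bump. Qed.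

Let ib : lam.-integrable [set: E] (EFin \o b).
Proof.
have := integrableZl measurableT (c e)^-1 (integrable_bump Hlam e0).
by apply: eq_integrable => // z _ /=; rewrite -EFinM mulrC.
Qed.

Let Rintegral_b : Rintegral lam [set: E] b = 1.
Proof. by rewrite RintegralZr ?divff ?gt_eqF//; exact: integrable_bump. Qed.

Let average_integrable (h : E -> R) (B : R) : measurable_fun [set: E] h ->
  (forall z, b z != 0 -> `|h z| <= B) ->
  lam.-integrable [set: E] (EFin \o (fun z => h z * b z)).
Proof.
move=> mh hB; have := integrableZl measurableT B ib; apply: le_integrable => //.
  by apply/measurable_EFinP; exact: measurable_funM.
move=> z _; rewrite /= lee_fin (normrM (h z)) (normrM B).
have [->|bz] := eqVneq (b z) 0; first by rewrite normr0 !mulr0.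
by rewrite ler_wpM2r// (le_trans (hB z bz))// ler_norm.
Qed.

(** [b] is a probability density. The bound on [h] is asked only where [b] is nonzero, so that
    [moll_dist] may use [|z_j| < e] there. *)
Let average_le (h : E -> R) (B : R) : measurable_fun [set: E] h ->
  (forall z, b z != 0 -> `|h z| <= B) ->
  `|Rintegral lam [set: E] (fun z => h z * b z)| <= B.
Proof.
move=> mh hB; have ih := average_integrable mh hB.
apply: le_trans (le_normr_Rintegral measurableT ih) _.
rewrite -[leRHS]mulr1 -Rintegral_b -RintegralZl//.
apply: le_Rintegral => //.
- exact: (integrable_norm ih).
- exact: (integrableZl measurableT B ib).
move=> z _; have H : `|h z| * b z <= B * b z.
  have [->|bz] := eqVneq (b z) 0; first by rewrite !mulr0.
  by rewrite ler_wpM2r// hB.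
by apply: le_trans H; rewrite /= normrM (ger0_norm (b_ge0 z)).
Qed.

Let mgT (x : 'rV[R]_n) : measurable_fun [set: E] (fun z : E => g ((z : 'rV[R]_n) + x)).
Proof. exact: (measurableT_comp mg (@measurable_translation R n x)). Qed.

Let igb (x : 'rV[R]_n) :
  lam.-integrable [set: E] (EFin \o (fun z : E => g ((z : 'rV[R]_n) + x) * b z)).
Proof. by apply: (@average_integrable _ K) => // z _; exact: gK. Qed.

Let mollE (x : 'rV[R]_n) :
  moll e x = Rintegral lam [set: E] (fun z : E => g ((z : 'rV[R]_n) + x) * b z).
Proof.
have mpx : measurable_fun [set: E] (fun w : E => psi (w, (x : E))).
  exact: (measurableT_comp mpsi).
have EQ : (fun z : E => g ((z : 'rV[R]_n) + x) / c e * bumpf e ((z : 'rV[R]_n) + x - x)) =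
    (fun z : E => g ((z : 'rV[R]_n) + x) * b z).
  by apply/funext => z; rewrite addrK /b mulrAC mulrA.
rewrite /moll (@Rintegral_translation R n lam Hlam x); first by rewrite EQ.
- exact: mpx.
- by rewrite EQ; exact: igb.
Qed.

Let b_supp (z : E) : b z != 0 -> forall j, `|z ord0 j : R| < e.
Proof.
rewrite /b mulf_eq0 negb_or => /andP[bz _]; apply/(bump_gt0 _ e0).
by rewrite lt0r bz bump_ge0.
Qed.

(** The constant of [g] survives, independently of [e]; this uniformity yields one majorant for the
    limit [e -> 0]. *)
Lemma moll_lipschitz (x y : 'rV[R]_n) : `|moll e x - moll e y| <= L * enorm (x - y).
Proof.
rewrite !mollE -RintegralB//; under eq_Rintegral do rewrite -mulrBl.
apply: average_le; first exact: measurable_funB.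
move=> z _; apply: le_trans (gL _ _) _.
by rewrite opprD addrACA subrr add0r.
Qed.

Lemma moll_bounded (x : 'rV[R]_n) : `|moll e x| <= K.
Proof. by rewrite mollE; apply: average_le => // z _; exact: gK. Qed.

Lemma moll_support (x : 'rV[R]_n) : moll e x != 0 -> forall j, `|x ord0 j| < M + e.
Proof.
move=> mx j; rewrite ltNge; apply: contra mx => xj.
rewrite mollE (_ : (fun z : E => _) = (fun=> 0)); first by rewrite /Rintegral integral0.
apply/funext => z; have [->|bz] := eqVneq (b z) 0; first by rewrite mulr0.
have [->|gz] := eqVneq (g ((z : 'rV[R]_n) + x)) 0; first by rewrite mul0r.
have := gM gz j; have := b_supp bz j; rewrite !mxE => h1 h2.
have := ler_normB (z ord0 j + x ord0 j) (z ord0 j).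
rewrite addrAC subrr add0r => /(le_trans xj); rewrite leNgt.
by rewrite ler_ltD.
Qed.

Lemma moll_dist (x : 'rV[R]_n) : `|moll e x - g x| <= L * (n%:R * e).
Proof.
have -> : g x = Rintegral lam [set: E] (fun z => g x * b z).
  by rewrite RintegralZl// Rintegral_b mulr1.
rewrite mollE -RintegralB//; last exact: (integrableZl measurableT _ ib).
under eq_Rintegral do rewrite -mulrBl.
apply: average_le; first exact: measurable_funB.
move=> z bz; apply: le_trans (gL _ _) _; rewrite addrK ler_wpM2l//.
apply: le_trans (enorm_le_sum _) _.
rewrite mulr_natl -[X in _ *+ X](card_ord n) -sumr_const.
by apply: ler_sum => j _; exact/ltW/b_supp.
Qed.

End fixed_scale.

Lemma defect_lipschitz i : defect alpha lam f (mup i) (mun i) i g = 0.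
Proof.
pose e k : R := k.+1%:R^-1.
have e0 k : 0 < e k by rewrite invr_gt0.
have e1 k : e k <= 1 by rewrite invf_le1// ler1n.
have cg (x : 'rV[R]_n) : moll (e k) x @[k --> \oo] --> g x.
  apply/cvgrPdist_le => d d0.
  have D0 : 0 < L * n%:R + 1 by rewrite ltr_wpDl// mulr_ge0.
  near=> k; rewrite distrC; apply: le_trans (moll_dist (e0 k) x) _.
  rewrite mulrA; apply: (@le_trans _ _ ((L * n%:R + 1) * e k)).
    by rewrite ler_wpM2r ?(ltW (e0 k))// lerDl.
  rewrite mulrC -ler_pdivlMr//; near: k.
  have := @near_infty_natSinv_lt R (PosNum (divr_gt0 d0 D0)).
  by apply: filterS => k /ltW.
(* As [e k <= 1], this cube contains all the supports; with [L] and [K] common to all [k], one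
   [wdom] dominates the whole sequence. *)
pose S : set E := cube 0 (M + 1).
have mS : measurable S by exact: measurable_box.
have lamS : (lam S < +oo)%E by rewrite /S (lebesgue_cube Hlam) ?ltry// addr_ge0.
have mm k : measurable_fun [set: E] (moll (e k) : E -> R).
  apply: continuous_measurable_Rn; apply: lipschitz_continuous.
  exact: (moll_lipschitz (e0 k)).
have inS (x : E) k : moll (e k) x != 0 -> S x.
  move=> /(moll_support (e0 k)) H j; rewrite !mxE !add0r.
  have : `|x ord0 j : R| < M + 1 by rewrite (lt_le_trans (H j))// lerD2l.
  by rewrite ltr_norml => /andP[/ltW -> ->].
pose A := Num.max L (2 * K).
have A0 : 0 <= A by rewrite le_max L0.
have tm k : tame S A (moll (e k)).
  apply: tame_lipschitz; [exact: (moll_lipschitz (e0 k))|exact: (moll_bounded (e0 k))|].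
  by move=> x; exact: inS.
have iw := @wdom_integrable _ _ _ n_gt0 alpha01 _ Hlam _ _ p_gt1 mf Lf S mS lamS.
have mdens (h : E -> R) : measurable_fun [set: E] h ->
    measurable_fun [set: E * E] (dens alpha f i h).
  move=> mh; apply: measurable_funM; first exact: (measurableT_comp mf).
  apply: measurable_funM; first exact: measurable_qker.
  by apply: measurable_funB; exact: (measurableT_comp mh).
have c1 : weak alpha lam f i (moll (e k)) @[k --> \oo] --> weak alpha lam f i g.
  apply: (@Rintegral_dominated_cvg _ _ _ _ _ _
     (fun u => `|A * (f u.1 * wdom alpha S u)|)).
  - by move=> k; exact: mdens.
  - exact: mdens.
  - move=> u; apply: cvgM; first exact: cvg_cst.
    apply: cvgM; first exact: cvg_cst.
    by apply: cvgB; exact: cg.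
  - exact: (integrable_norm (integrableZl measurableT A iw)).
  - by move=> k u; apply: weighted_le; exact: (tm k u.1 u.2).
have cm (m : {finite_measure set E -> \bar R}) :
    Rintegral m [set: E] (moll (e k)) @[k --> \oo] --> Rintegral m [set: E] g.
  apply: (@Rintegral_dominated_cvg _ _ _ _ _ _ (fun=> K)) => //.
    exact: finite_measure_integrable_cst.
  by move=> k x; exact: (moll_bounded (e0 k)).
have : defect alpha lam f (mup i) (mun i) i (moll (e k)) @[k --> \oo] -->
    defect alpha lam f (mup i) (mun i) i g.
  apply: cvgD; first by apply: cvgM => //; exact: cvg_cst.
  by apply: cvgB; exact: cm.
under eq_fun do rewrite defect_moll//.
by move/(@cvg_unique _ (@Rhausdorff R)) => /(_ _ (cvg_cst _)).
Unshelve. all: by end_near.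
Qed.

End mollification.

(** * Balls *)

Section balls.
Variables (R : realType) (n : nat) (alpha : R).
Local Notation E := (Rn R n).
Hypotheses (n_gt0 : (0 < n)%N) (alpha01 : 0 < alpha < 1).
Variable lam : {sigma_finite_measure set E -> \bar R}.
Hypothesis Hlam : is_lebesgue_Rn lam.
Local Notation P := (lam \x lam)%E.
Local Notation leb := (@lebesgue_measure R).
Variables (p : \bar R) (f : E -> R).
Hypotheses (p_gt1 : (1 < p)%E) (mf : measurable_fun [set: E] f).
Hypothesis Lf : (Lnorm lam p (EFin \o f) < +oo)%E.
Variables (mup mun : 'I_n -> {finite_measure set E -> \bar R}).
Hypothesis HD : is_Dalpha lam alpha f mup mun.
Variables (g : 'rV[R]_n -> R) (L K M : R).
Hypotheses (L0 : 0 <= L) (K0 : 0 <= K) (M0 : 0 <= M).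
Hypothesis gL : forall x y, `|g x - g y| <= L * enorm (x - y).
Hypothesis gK : forall x, `|g x| <= K.
Hypothesis gM : forall x, g x != 0 -> forall j, `|x ord0 j| <= M.
Variable x : 'rV[R]_n.

Let mg : measurable_fun [set: E] (g : E -> R).
Proof. by apply: continuous_measurable_Rn; exact: lipschitz_continuous gL. Qed.

Definition chi (s : R) (y : 'rV[R]_n) : R := \1_(eball x s) y.

Lemma chiE s y : chi s y = (enorm (y - x) < s)%R%:R.
Proof.
rewrite /chi indicE; congr (_%:R); congr nat_of_bool.
by apply/idP/idP; rewrite inE.
Qed.

Let S : set E := cube 0 (M + 1).
Let mS : measurable S. Proof. exact: measurable_box. Qed.
Let lamS : (lam S < +oo)%E.
Proof. by rewrite /S (lebesgue_cube Hlam) ?ltry// addr_ge0. Qed.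
Let gS (y : E) : g y != 0 -> S y.
Proof.
move=> /gM H j; rewrite !mxE !add0r.
have : `|y ord0 j : R| < M + 1 by rewrite (le_lt_trans (H j))// ltrDl.
by rewrite ltr_norml => /andP[/ltW -> ->].
Qed.

(** * Averages over bounded sets of radii *)

Section slab.
Variables (N : nat) (A : set R).
Hypotheses (mA : measurable A) (AN : A `<=` `[0, N%:R]%classic).

Let psi (v : R * E) : R := \1_A v.1 * (chi v.1 v.2 * g v.2).

Lemma measurable_chi : measurable_fun [set: R * E] (fun v : R * E => chi v.1 v.2).
Proof.
have me : measurable_fun [set: R * E] (fun v : R * E => enorm ((v.2 : 'rV[R]_n) - x)).
  apply: measurable_enorm => i; under eq_fun do rewrite !mxE.
  apply: measurable_funB => //.
  exact: (measurableT_comp (measurable_coord i) measurable_snd).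
have mB : measurable [set v : R * E | enorm ((v.2 : 'rV[R]_n) - x) < v.1].
  have mlt := measurable_fun_ltr me measurable_fst.
  have := mlt measurableT [set true] I.
  by rewrite setTI.
rewrite (_ : (fun v => _) = \1_[set v : R * E | enorm ((v.2 : 'rV[R]_n) - x) < v.1]).
  exact: measurable_indic.
apply/funext => v; rewrite chiE indicE; congr (_%:R); congr nat_of_bool.
by apply/idP/idP; rewrite inE.
Qed.

Let mpsi : measurable_fun [set: R * E] psi.
Proof.
apply: measurable_funM.
  by apply: (@measurableT_comp _ _ _ _ _ _ (\1_A : R -> R)) => //; exact: measurable_indic.
apply: measurable_funM; first exact: measurable_chi.
exact: (measurableT_comp mg measurable_snd).
Qed.

Let leb_A : (leb A <= N%:R%:E)%E.
Proof.
apply: (@le_trans _ _ (leb `[0, N%:R]%classic)).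
  by apply: le_measure; rewrite ?inE.
by rewrite lebesgue_measure_itv/= lte_fin; case: ifPn => _; rewrite ?sube0.
Qed.

Let integral_A : (\int[leb]_s (\1_A s)%:E = leb A)%E.
Proof. by rewrite integral_indic// setIT. Qed.

Let C : R := Num.max n%:R N%:R.

Let mchiy (y : E) : measurable_fun [set: R] (fun s : R => chi s y).
Proof.
rewrite (_ : (fun s => _) = \1_(`]enorm ((y : 'rV[R]_n) - x), +oo[%classic)).
  exact: measurable_indic.
apply/funext => s; rewrite chiE indicE; congr (_%:R); congr nat_of_bool.
by apply/idP/idP; rewrite inE/= in_itv/= andbT.
Qed.

(** The two indicators differ only for radii between [|y - x|] and [|z - x|], an interval of length
    at most [n |z - y|]. For distant points the measure of [A], at most [N], is used instead; hence
    [C = max n N]. *)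
Lemma integral_chi_dist (y z : E) :
  (\int[leb]_s (\1_A s * `|chi s z - chi s y|)%:E <= (C * Num.min 1 (dist2 (y, z)))%:E)%E.
Proof.
have mi : measurable_fun [set: R] (fun s : R => (\1_A s * `|chi s z - chi s y|)%:E).
  apply/measurable_EFinP/measurable_funM; first exact: measurable_indic.
  by apply: measurableT_comp => //; exact: measurable_funB.
have chi01 s w : chi s w = 0 \/ chi s w = 1.
  by rewrite chiE; case: (_ < _); [right|left].
have d1 s : `|chi s z - chi s y| <= 1.
  by case: (chi01 s z) => ->; case: (chi01 s y) => ->;
    rewrite ?subrr ?subr0 ?sub0r ?normrN ?normr0 ?normr1.
rewrite /Num.min; case: ifPn => _.
  rewrite mulr1; apply: (@le_trans _ _ N%:R%:E); last by rewrite lee_fin le_max lexx orbT.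
  apply: le_trans leb_A; rewrite -integral_A.
  apply: ge0_le_integral => //.
  - by apply/measurable_EFinP; exact: measurable_indic.
  - by move=> s _; rewrite lee_fin -[leRHS]mulr1 ler_wpM2l.
pose a := enorm ((y : 'rV[R]_n) - x); pose b := enorm ((z : 'rV[R]_n) - x).
pose J := `]Num.min a b, Num.max a b]%classic : set R.
apply: (@le_trans _ _ (\int[leb]_s (\1_J s)%:E)%E).
  apply: ge0_le_integral => //.
  - apply/measurable_EFinP; apply: measurable_indic; exact: measurable_itv.
  - move=> s _; rewrite lee_fin.
    apply: (@le_trans _ _ `|chi s z - chi s y|).
      by rewrite -[leRHS]mul1r ler_wpM2r// indicE; case: (_ \in _).
    have [sJ|sJ] := boolP (s \in J); first by rewrite indicE sJ.
    rewrite indicE (negbTE sJ) normr_le0 subr_eq0 !chiE -/a -/b.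
    apply/eqP; congr (_%:R); congr nat_of_bool.
    move: sJ; rewrite notin_setE /J/= in_itv/= gt_min le_max.
    by case: (ltP a s) => ha; case: (ltP b s) => hb //= [].
rewrite integral_indic; [|exact: measurableT|exact: measurable_itv].
rewrite setIT; suff : (leb J <= (C * dist2 (y, z))%:E)%E by [].
rewrite /J lebesgue_measure_itv/= lte_fin.
have dab : `|a - b| <= n%:R * dist2 (y, z).
  apply: le_trans (enorm_dist _ _) _; rewrite /dist2 -enormN /=.
  by rewrite (_ : - _ = (z : 'rV[R]_n) - y)// !opprB addrA subrK.
have X0 : 0 <= n%:R * dist2 (y, z) by apply: le_trans dab.
have CX : n%:R * dist2 (y, z) <= C * dist2 (y, z).
  by rewrite ler_wpM2r ?enorm_ge0// le_max lexx.
case: ifPn => [ab|_]; last by rewrite lee_fin (le_trans X0).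
rewrite -EFinB lee_fin; apply: le_trans CX; apply: le_trans dab.
case: (leP a b) => h; last exact: ler_norm.
by rewrite distrC ler_norm.
Qed.

Let C0 : 0 <= C. Proof. by rewrite le_max ler0n. Qed.

Let G : R := Num.max L (2 * K).
Let G0 : 0 <= G. Proof. by rewrite le_max L0. Qed.
(** Constant of the product rule [c(z) g(z) - c(y) g(y) = c(z) (g(z) - g(y)) + (c(z) - c(y)) g(y)],
    integrated over the radii in [A]. *)
Let B0 : R := N%:R * G + K * C.
Let B00 : 0 <= B0. Proof. by rewrite addr_ge0 ?mulr_ge0. Qed.

Let tg : tame S G (g : E -> R).
Proof. exact: tame_lipschitz gL gK gS. Qed.

Let X (y z : E) : R := (\1_S y + \1_S z) * Num.min 1 (dist2 (y, z)).

Let min0 (y z : E) : 0 <= Num.min 1 (dist2 (y, z)).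
Proof. by rewrite le_min ler01 enorm_ge0. Qed.

Let X0 (y z : E) : 0 <= X y z.
Proof. by rewrite mulr_ge0// addr_ge0. Qed.

Let mpsiy (y : E) : measurable_fun [set: R] (fun s : R => psi (s, y)).
Proof.
have h1 : measurable_fun [set: R] (\1_A : R -> R) by exact: measurable_indic.
have h2 : measurable_fun [set: R] (fun s : R => chi s y * g y).
  exact: (@measurable_funM _ _ _ _ (chi^~ y) (cst (g y)) (mchiy y)).
exact: (measurable_funM h1 h2).
Qed.

Let chi_le1 s y : 0 <= chi s y <= 1.
Proof. by rewrite chiE; case: (_ < _); rewrite ?lexx ?ler01. Qed.

Let A_le1 (s : R) : 0 <= (\1_A s : R) <= 1.
Proof. by rewrite indicE; case: (_ \in _); rewrite ?lexx ?ler01. Qed.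

Let hA1 (y z : E) : (\int[leb]_s `|psi (s, z) - psi (s, y)|%:E <=
  (N%:R * `|g z - g y| + K * (C * Num.min 1 (dist2 (y, z))))%:E)%E.
Proof.
have mc : measurable_fun [set: R] (fun s : R => \1_A s * `|chi s z - chi s y|).
  apply: measurable_funM; first exact: measurable_indic.
  exact: (measurableT_comp _ (measurable_funB (mchiy z) (mchiy y))).
have mA' : measurable_fun [set: R] (fun s : R => `|g z - g y| * \1_A s).
  by apply: measurable_funM => //; exact: measurable_indic.
have mKc : measurable_fun [set: R] (fun s : R => K * (\1_A s * `|chi s z - chi s y|)).
  exact: measurable_funM.
apply: (@le_trans _ _ (\int[leb]_s ((`|g z - g y| * \1_A s)%:E +
   (K * (\1_A s * `|chi s z - chi s y|))%:E))%E).
  apply: ge0_le_integral => //.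
  - apply/measurable_EFinP.
    exact: (measurableT_comp _ (measurable_funB (mpsiy z) (mpsiy y))).
  - by apply: emeasurable_funD; exact/measurable_EFinP.
  - move=> s _; rewrite -EFinD lee_fin /psi /= -mulrBr normrM.
    have /andP[A0 _] := A_le1 s; have /andP[c0 c1] := chi_le1 s z.
    rewrite (ger0_norm A0) mulrC (mulrCA K) (mulrC (\1_A s)) -mulrDl ler_wpM2r//.
    have -> : chi s z * g z - chi s y * g y =
      chi s z * (g z - g y) + (chi s z - chi s y) * g y by ring.
    apply: le_trans (ler_normD _ _) _; rewrite !normrM; apply: lerD.
      by rewrite -[leRHS]mul1r ler_wpM2r// ger0_norm.
    by rewrite mulrC ler_wpM2r.
rewrite ge0_integralD//; try exact/measurable_EFinP; last first.
  by move=> s _; rewrite lee_fin !mulr_ge0.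
rewrite EFinD; apply: leeD.
  under eq_integral do rewrite EFinM.
  rewrite ge0_integralZl//; last first.
    by apply/measurable_EFinP; exact: measurable_indic.
  by rewrite integral_A EFinM muleC lee_wpmul2r// lee_fin.
under eq_integral do rewrite EFinM.
rewrite ge0_integralZl//; last exact/measurable_EFinP.
by rewrite EFinM lee_wpmul2l ?lee_fin//; exact: integral_chi_dist.
Qed.

(** Inserts the support weight into [hA1]: if [g] is nonzero at one of the points, that point is in
    [S] and the weight is at least 1; if [g] vanishes at both, so does the integrand. *)
Let hA (y z : E) : (\int[leb]_s `|psi (s, z) - psi (s, y)|%:E <= (B0 * X y z)%:E)%E.
Proof.
have fin : Num.min 1 (dist2 (y, z)) <= X y z ->
    (\int[leb]_s `|psi (s, z) - psi (s, y)|%:E <= (B0 * X y z)%:E)%E.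
  move=> mX; apply: le_trans (hA1 y z) _; rewrite lee_fin /B0 mulrDl; apply: lerD.
    by rewrite -mulrA ler_wpM2l//; exact: tg.
  by rewrite -mulrA ler_wpM2l// ler_wpM2l.
have S1 (w : E) : g w != 0 -> \1_S w = 1 :> R.
  by move=> /gS Sw; rewrite indicE mem_set.
have [gy|/S1 Sy] := eqVneq (g y) 0; last first.
  by apply: fin; rewrite /X -[leLHS]mul1r ler_wpM2r// Sy lerDl.
have [gz|/S1 Sz] := eqVneq (g z) 0; last first.
  by apply: fin; rewrite /X -[leLHS]mul1r ler_wpM2r// Sz lerDr.
under eq_integral do rewrite /psi /= gy gz !mulr0 subrr normr0.
by rewrite integral0 lee_fin mulr_ge0.
Qed.

Let hB (y : E) : (\int[leb]_s `|psi (s, y)|%:E <= (K * N%:R)%:E)%E.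
Proof.
apply: (@le_trans _ _ (\int[leb]_s (K%:E * (\1_A s)%:E))%E).
  apply: ge0_le_integral => //.
  - by apply/measurable_EFinP; exact: (measurableT_comp _ (mpsiy y)).
  - by apply: emeasurable_funM => //; apply/measurable_EFinP; exact: measurable_indic.
  - move=> s _; rewrite -EFinM lee_fin /psi /= normrM mulrC.
    have /andP[A0 _] := A_le1 s; have /andP[c0 c1] := chi_le1 s y.
    rewrite (ger0_norm A0) ler_wpM2r// normrM -[leRHS]mul1r ler_pM// ger0_norm//.
rewrite ge0_integralZl//; last by apply/measurable_EFinP; exact: measurable_indic.
by rewrite integral_A EFinM lee_wpmul2l// lee_fin.
Qed.

Let gbar (y : E) : R := Rintegral leb [set: R] (fun s => psi (s, y)).

Let ipsi (y : E) : leb.-integrable [set: R] (EFin \o (fun s => psi (s, y))).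
Proof.
apply/integrableP; split; first by apply/measurable_EFinP; exact: mpsiy.
exact: le_lt_trans (hB y) (ltry _).
Qed.

Let gbar_lip (y z : 'rV[R]_n) : `|gbar y - gbar z| <= B0 * 2 * enorm (y - z).
Proof.
rewrite distrC /gbar -RintegralB//.
rewrite -lee_fin; apply: (@le_trans _ _ (B0 * X y z)%:E); last first.
  rewrite lee_fin -mulrA ler_wpM2l// /X ler_pM ?addr_ge0//.
    by rewrite (_ : 2 = 1 + 1)// lerD// indicE; case: (_ \in _).
  by rewrite ge_min /dist2 /= -enormN opprB lexx orbT.
apply: le_trans (hA y z); rewrite EFin_normr_Rintegral//; last first.
  exact: (integrableB measurableT (ipsi z) (ipsi y)).
apply: le_abse_integral => //; apply/measurable_EFinP.
exact: (measurable_funB (mpsiy z) (mpsiy y)).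
Qed.

Let gbar_bnd (y : 'rV[R]_n) : `|gbar y| <= K * N%:R.
Proof.
rewrite -lee_fin; apply: le_trans (hB y).
rewrite EFin_normr_Rintegral//.
by apply: le_abse_integral => //; apply/measurable_EFinP; exact: mpsiy.
Qed.

Let gbar_supp (y : 'rV[R]_n) : gbar y != 0 -> forall j, `|y ord0 j| <= M.
Proof.
move=> gy; apply: gM; apply: contra gy => /eqP gy0.
rewrite /gbar (_ : (fun s => _) = (fun=> 0)); first by rewrite /Rintegral integral0.
by apply/funext => s; rewrite /psi /= gy0 !mulr0.
Qed.

(** Its sections in [s] are integrable for almost every [s], which is how [dens] becomes integrable
    at individual radii. *)
Lemma slab_integrable i : (leb \x product_sf lam lam)%E.-integrable setT
    (EFin \o (fun v : R * (E * E) =>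
       dens alpha f i (fun y => \1_A v.1 * (chi v.1 y * g y)) v.2)).
Proof.
exact: (@superposition_dens_integrable R n alpha n_gt0 alpha01 lam Hlam p f p_gt1 mf Lf
  _ _ leb psi mpsi S B0 mS lamS hA i).
Qed.

Lemma slab_defect i :
  leb.-integrable [set: R] (EFin \o (fun s =>
    defect alpha lam f (mup i) (mun i) i (fun y => \1_A s * (chi s y * g y)))) /\
  Rintegral leb [set: R] (fun s =>
    defect alpha lam f (mup i) (mun i) i (fun y => \1_A s * (chi s y * g y))) = 0.
Proof.
have [i1 ->] := @superposition R n alpha n_gt0 alpha01 lam Hlam p f p_gt1 mf Lf
  (mup i) (mun i) _ _ leb psi mpsi S B0 (K * N%:R) mS lamS hA hB i.
split => //; apply: (@defect_lipschitz R n alpha n_gt0 alpha01 lam Hlam p f p_gt1 mf Lf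
  mup mun HD gbar (B0 * 2) (K * N%:R) M) => //.
- exact: mulr_ge0.
- exact: mulr_ge0.
Qed.

End slab.

Lemma ball_defect_slab i (N : nat) : {ae leb, forall s, 0 <= s <= N%:R ->
  P.-integrable [set: E * E] (EFin \o dens alpha f i (fun y => chi s y * g y)) /\
  defect alpha lam f (mup i) (mun i) i (fun y => chi s y * g y) = 0}.
Proof.
pose D : set R := `[0, N%:R]%classic.
have mD : measurable D by exact: measurable_itv.
pose h s := defect alpha lam f (mup i) (mun i) i (fun y => chi s y * g y).
(* Done by cases on [s \in A] and not by linearity of the integral, since [dens] may fail to be
   integrable at this [s]. *)
have hE (A : set R) s :
    defect alpha lam f (mup i) (mun i) i (fun y => \1_A s * (chi s y * g y)) = \1_A s * h s.
  rewrite indicE; case: (s \in A).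
    by under [X in defect _ _ _ _ _ _ X]eq_fun do rewrite mul1r; rewrite mul1r.
  rewrite mul0r; under [X in defect _ _ _ _ _ _ X]eq_fun do rewrite mul0r.
  rewrite /defect charge_integral0 addr0 /weak /Rintegral.
  under eq_integral do rewrite /dens subrr !mulr0.
  by rewrite integral0 mulr0.
have restE (A : set R) : (EFin \o h) \_ A = EFin \o (fun s => \1_A s * h s).
  by apply/funext => s /=; rewrite patchE indicE; case: ifPn => _ /=; rewrite ?mul1r ?mul0r.
have ih (A : set R) : measurable A -> A `<=` D ->
    leb.-integrable setT (EFin \o (fun s => \1_A s * h s)) /\
    Rintegral leb setT (fun s => \1_A s * h s) = 0.
  by move=> mA AD; have := slab_defect mA AD i; under eq_fun do rewrite hE.
(* The integral of [h] is 0 over every measurable subset of [D], so [h] vanishes almost everywhere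
   on [D]. *)
have h0 : ae_eq leb D (EFin \o h) (cst 0%E).
  apply: integral_ae_eq => //.
    by apply/integrable_mkcond => //; rewrite restE; have [] := ih D mD (@subset_refl _ D).
  move=> A AD mA; rewrite integral_mkcond restE integral0.
  have [i1 i2] := ih A mA AD.
  by rewrite -[LHS]fineK ?integrable_fin_num//; congr EFin.
have h1 := ae_integrable1 (slab_integrable mD (@subset_refl _ D) i).
move: h0 h1; apply: filterS2 => s h0 h1 /= s0N.
have sD : D s by rewrite /D/= in_itv.
split; last by have [] := h0 sD.
apply: eq_integrable h1 => // u _ /=.
by rewrite /dens indicE mem_set// !mul1r.
Qed.

Lemma ball_defect i : {ae leb, forall s, 0 < s ->
  P.-integrable [set: E * E] (EFin \o dens alpha f i (fun y => chi s y * g y)) /\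
  defect alpha lam f (mup i) (mun i) i (fun y => chi s y * g y) = 0}.
Proof.
have := ae_foralln (ball_defect_slab i); apply: filterS => s H s0.
by apply: (H (Num.truncn s).+1); rewrite ltW//= ltW// truncnS_gt.
Qed.

End balls.

(** * The Leibniz rule on balls *)

Lemma integrable_sum_EFin d (T : measurableType d) (R : realType)
    (mu : {measure set T -> \bar R}) (I : Type) (s : seq I) (F : I -> T -> R) :
  (forall i, mu.-integrable [set: T] (EFin \o F i)) ->
  mu.-integrable [set: T] (EFin \o (fun x => \sum_(i <- s) F i x)).
Proof.
move=> iF; have := @integrable_sum _ _ _ mu setT measurableT _ s xpredT
  (fun i => EFin \o F i) (fun i _ => iF i).
by apply: eq_integrable => // x _ /=; rewrite sumEFin.
Qed.

Lemma Rintegral_sum d (T : measurableType d) (R : realType)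
    (mu : {measure set T -> \bar R}) (I : Type) (s : seq I) (F : I -> T -> R) :
  (forall i, mu.-integrable [set: T] (EFin \o F i)) ->
  Rintegral mu [set: T] (fun x => \sum_(i <- s) F i x) =
  \sum_(i <- s) Rintegral mu [set: T] (F i).
Proof.
move=> iF; elim: s => [|i s ih].
  rewrite big_nil; under eq_Rintegral do rewrite big_nil.
  by rewrite /Rintegral integral0.
rewrite big_cons -ih -RintegralD//; last exact: integrable_sum_EFin.
by apply: eq_Rintegral => x _; rewrite big_cons.
Qed.

Lemma Rintegral_indic d (T : measurableType d) (R : realType)
    (mu : {measure set T -> \bar R}) (A : set T) (h : T -> R) :
  Rintegral mu A h = Rintegral mu [set: T] (fun y => \1_A y * h y).
Proof.
rewrite Rintegral_mkcond; apply: eq_Rintegral => y _.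
by rewrite patchE indicE; case: ifPn => _; rewrite ?mul1r ?mul0r.
Qed.

Lemma lipc_component (R : realType) (n : nat) (phi : 'rV[R]_n -> 'rV[R]_n) :
  (0 < n)%N -> Lipc phi ->
  exists L K M : R, [/\ 0 <= L, 0 <= K, 0 <= M & forall i : 'I_n,
    [/\ forall x y, `|phi x ord0 i - phi y ord0 i| <= L * enorm (x - y),
        forall x, `|phi x ord0 i| <= K &
        forall x, phi x ord0 i != 0 -> forall j, `|x ord0 j| <= M]].
Proof.
move=> n0 [[L HL] /bounded_compact_support[M M0 HM]].
have gL i x y : `|phi x ord0 i - phi y ord0 i| <= `|L| * enorm (x - y).
  have := coord_le_enorm (phi x - phi y) i; rewrite !mxE => /le_trans; apply.
  apply: le_trans (HL x y) _.
  by rewrite ler_wpM2r ?enorm_ge0// ler_norm.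
have gM i x : phi x ord0 i != 0 -> forall j, `|x ord0 j| <= M.
  by move=> px; apply: HM; apply: contra px => /eqP ->; rewrite mxE.
exists `|L|, (`|L| * (n%:R * (M + (M + 1)))), M; split => // [|| i].
- by rewrite !mulr_ge0// !addr_ge0// ltW.
- exact: ltW.
split => // x; first last.
  exact: gM.
have [->|px] := eqVneq (phi x ord0 i) 0.
  by rewrite normr0 !mulr_ge0// !addr_ge0// ltW.
(* A point off the support, some coordinate exceeding [M] because [n > 0]. Comparing with it through
   the Lipschitz bound gives the sup bound, each [|x_j - x'_j|] being at most [M + (M + 1)]. *)
pose x' : 'rV[R]_n := \row__ (M + 1).
have px' : phi x' ord0 i = 0.
  apply/eqP/negPn/negP => /gM/(_ (Ordinal n0)); rewrite mxE.
  by rewrite ger0_norm ?addr_ge0 ?(ltW M0)// leNgt ltrDl ltr01.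
have := gL i x x'; rewrite px' subr0 => /le_trans; apply.
rewrite ler_wpM2l//; apply: le_trans (enorm_le_sum _) _.
rewrite mulr_natl -[X in _ *+ X](card_ord n) -sumr_const.
apply: ler_sum => j _; rewrite !mxE; apply: le_trans (ler_normB _ _) _.
by rewrite lerD ?(gM i x px)// ger0_norm// addr_ge0// ltW.
Qed.

Section assembly.
Variables (R : realType) (n : nat) (alpha : R).
Local Notation E := (Rn R n).
Hypotheses (n_gt0 : (0 < n)%N) (alpha01 : 0 < alpha < 1).
Variable lam : {sigma_finite_measure set E -> \bar R}.
Hypothesis Hlam : is_lebesgue_Rn lam.
Local Notation P := (lam \x lam)%E.
Variables (p : \bar R) (f : E -> R).
Hypotheses (p_gt1 : (1 < p)%E) (mf : measurable_fun [set: E] f).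
Hypothesis Lf : (Lnorm lam p (EFin \o f) < +oo)%E.
Variables (mup mun : 'I_n -> {finite_measure set E -> \bar R}).
Variables (phi : 'rV[R]_n -> 'rV[R]_n) (L K M : R).
Hypothesis M0 : 0 <= M.
Hypothesis phiL : forall i x y, `|phi x ord0 i - phi y ord0 i| <= L * enorm (x - y).
Hypothesis phiK : forall i x, `|phi x ord0 i| <= K.
Hypothesis phiM : forall i x, phi x ord0 i != 0 -> forall j, `|x ord0 j| <= M.
Variables (x : 'rV[R]_n) (r : R).
Local Notation c := (chi x r).
Hypothesis icphi : forall i,
  P.-integrable [set: E * E] (EFin \o dens alpha f i (fun y => c y * phi y ord0 i)).
Hypothesis dcphi : forall i,
  defect alpha lam f (mup i) (mun i) i (fun y => c y * phi y ord0 i) = 0.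

Let mphi i : measurable_fun [set: E] (fun y : E => phi y ord0 i).
Proof.
by apply: continuous_measurable_Rn; apply: lipschitz_continuous; exact: (phiL i).
Qed.

Let mc : measurable_fun [set: E] (c : E -> R).
Proof.
apply: measurable_indic.
have me : measurable_fun [set: E] (fun y : E => enorm ((y : 'rV[R]_n) - x)).
  apply: measurable_enorm => i; under eq_fun do rewrite !mxE.
  by apply: measurable_funB => //; exact: measurable_coord.
have mlt := measurable_fun_ltr me (measurable_cst r).
by have := mlt measurableT [set true] I; rewrite setTI.
Qed.

Let c01 y : 0 <= c y <= 1.
Proof. by rewrite chiE; case: (_ < _); rewrite ?lexx ?ler01. Qed.

Let S : set E := cube 0 (M + 1).
Let mS : measurable S. Proof. exact: measurable_box. Qed.
Let lamS : (lam S < +oo)%E.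
Proof. by rewrite /S (lebesgue_cube Hlam) ?ltry// addr_ge0. Qed.
Let phiS i (y : E) : phi y ord0 i != 0 -> S y.
Proof.
move=> /phiM H j; rewrite !mxE !add0r.
have : `|y ord0 j : R| < M + 1 by rewrite (le_lt_trans (H j))// ltrDl.
by rewrite ltr_norml => /andP[/ltW -> ->].
Qed.

Let tphi i : tame S (Num.max L (2 * K)) (fun y : E => phi y ord0 i).
Proof. exact: (tame_lipschitz (phiL i) (phiK i) (@phiS i)). Qed.

Let dphi i (u : E * E) : R := phi u.2 ord0 i - phi u.1 ord0 i.
Let dc (u : E * E) : R := c u.2 - c u.1.

Let mdphi i : measurable_fun [set: E * E] (dphi i).
Proof.
by apply: measurable_funB; [exact: (measurableT_comp (mphi i) measurable_snd)
  |exact: (measurableT_comp (mphi i) measurable_fst)].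
Qed.

Let mc1 : measurable_fun [set: E * E] (fun u : E * E => c u.1).
Proof. exact: (measurableT_comp mc measurable_fst). Qed.

Let mdc : measurable_fun [set: E * E] dc.
Proof.
by apply: measurable_funB; [exact: (measurableT_comp mc measurable_snd)|exact: mc1].
Qed.

Let ta i (u : E * E) : R := f u.1 * (qker alpha i u * (c u.1 * dphi i u)).
Let tb i (u : E * E) : R := f u.1 * (qker alpha i u * (dc u * phi u.1 ord0 i)).
Let tc i (u : E * E) : R := f u.1 * (qker alpha i u * (dc u * dphi i u)).

(** Covers the two terms with an increment of [phi]: the indicator, or its increment, is only a
    factor bounded by 1. *)
Let bounded_integrable i (k : E * E -> R) : measurable_fun [set: E * E] k ->
  (forall u, `|k u| <= 1) ->
  P.-integrable [set: E * E] (EFin \o (fun u => f u.1 * (qker alpha i u * (k u * dphi i u)))).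
Proof.
move=> mk k1; apply: (@weighted_integrable _ _ _ n_gt0 alpha01 _ Hlam _ _ p_gt1 mf Lf S mS lamS i
  (Num.max L (2 * K)) (fun u => k u * dphi i u)); first exact: measurable_funM.
move=> u; apply: le_trans (tphi i u.1 u.2).
by rewrite normrM -[leRHS]mul1r ler_wpM2r.
Qed.

Let ia i : P.-integrable [set: E * E] (EFin \o ta i).
Proof.
apply: bounded_integrable => // u.
by have /andP[h1 h2] := c01 u.1; rewrite ger0_norm.
Qed.

Let ic i : P.-integrable [set: E * E] (EFin \o tc i).
Proof.
apply: bounded_integrable => // u; rewrite /dc ler_norml.
have /andP[h1 h2] := c01 u.1; have /andP[h3 h4] := c01 u.2.
by apply/andP; split; lra.
Qed.

Let abcE i u : ta i u + tb i u + tc i u = dens alpha f i (fun y => c y * phi y ord0 i) u.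
Proof. by rewrite /ta /tb /tc /dens /dphi /dc; ring. Qed.

(** The increment of the indicator has no Lipschitz bound here, so this term is controlled by
    subtracting the other two from the full density, integrable at the chosen radius. *)
Let ib i : P.-integrable [set: E * E] (EFin \o tb i).
Proof.
have := integrableB measurableT (integrableB measurableT (icphi i) (ia i)) (ic i).
apply: eq_integrable => // u _ /=; rewrite -!EFinB; congr EFin.
by rewrite -abcE; ring.
Qed.

Let kernE (u : E * E) (v w : 'rV[R]_n) :
  dotv ((u.2 : 'rV[R]_n) - u.1) (v - w) * kern alpha u.1 u.2 =
  \sum_(i < n) qker alpha i u * (v ord0 i - w ord0 i).
Proof.
by rewrite /dotv mulr_suml; apply: eq_bigr => i _; rewrite /qker !mxE; ring.
Qed.

Let mdot : measurable_fun [set: E * E] (fun u : E * E =>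
  dotv ((u.2 : 'rV[R]_n) - u.1) (phi u.2 - phi u.1) * kern alpha u.1 u.2).
Proof.
under eq_fun do rewrite kernE; apply: measurable_sum => i.
by apply: measurable_funM; [exact: measurable_qker|exact: mdphi].
Qed.

Local Notation mu := (mu_na n alpha).

Lemma ball_term_div :
  Rintegral lam (eball x r : set E) (fun y => f y * fdiv lam alpha phi y) =
  mu * \sum_(i < n) Rintegral P [set: E * E] (ta i).
Proof.
rewrite Rintegral_indic -Rintegral_sum//.
have EQ : (fun u : E * E => (c u.1 * f u.1) *
    (dotv ((u.2 : 'rV[R]_n) - u.1) (phi u.2 - phi u.1) * kern alpha u.1 u.2)) =
    (fun u => \sum_(i < n) ta i u).
  apply/funext => u; rewrite kernE mulr_sumr; apply: eq_bigr => i _.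
  by rewrite /ta /dphi; ring.
have mcf : measurable_fun [set: E] (fun y : E => c y * f y) by exact: measurable_funM.
have := @Rintegral_weighted_fubini_scaled _ _ _ _ _ lam lam mu _ _ mcf mdot.
rewrite EQ => /(_ (integrable_sum_EFin _ ia))[_ <-].
by apply: eq_Rintegral => y _; exact: mulrA.
Qed.

Lemma ball_term_grad :
  Rintegral lam [set: E]
    (fun y => f y * dotv (phi y) (fgrad lam alpha (\1_(eball x r) : _ -> R) y)) =
  mu * \sum_(i < n) Rintegral P [set: E * E] (tb i).
Proof.
pose F i (u : E * E) : R := ((u.2 : 'rV[R]_n) - u.1) ord0 i * dc u * kern alpha u.1 u.2.
have mF i : measurable_fun [set: E * E] (F i).
  rewrite (_ : F i = fun u => qker alpha i u * dc u); last first.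
    by apply/funext => u; rewrite /F /qker mulrAC.
  by apply: measurable_funM => //; exact: measurable_qker.
have EQ i : (fun u : E * E => (f u.1 * phi u.1 ord0 i) * F i u) = tb i.
  by apply/funext => u; rewrite /F /tb /qker; ring.
have mfp i : measurable_fun [set: E] (fun y : E => f y * phi y ord0 i).
  exact: measurable_funM.
have H i := @Rintegral_weighted_fubini_scaled _ _ _ _ _ lam lam mu _ _ (mfp i) (mF i).
have {}H i : lam.-integrable [set: E] (EFin \o (fun y => f y * phi y ord0 i *
      (mu * Rintegral lam [set: E] (fun z => F i (y, z))))) /\
    Rintegral lam [set: E] (fun y => f y * phi y ord0 i *
      (mu * Rintegral lam [set: E] (fun z => F i (y, z)))) =
    mu * Rintegral P [set: E * E] (tb i).
  by move: (H i); rewrite EQ; apply.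
rewrite mulr_sumr.
under [RHS]eq_bigr do rewrite -(H _).2.
rewrite -Rintegral_sum; last by move=> i; exact: (H i).1.
apply: eq_Rintegral => y _; rewrite /dotv mulr_sumr; apply: eq_bigr => i _.
by rewrite mulrA mxE.
Qed.

Lemma ball_term_NL :
  Rintegral lam [set: E]
    (fun y => f y * fdivNL lam alpha (\1_(eball x r) : _ -> R) phi y) =
  mu * \sum_(i < n) Rintegral P [set: E * E] (tc i).
Proof.
rewrite -Rintegral_sum//.
pose F (u : E * E) : R := dc u *
    dotv ((u.2 : 'rV[R]_n) - u.1) (phi u.2 - phi u.1) * kern alpha u.1 u.2.
have EQ : (fun u : E * E => f u.1 * F u) = (fun u => \sum_(i < n) tc i u).
  apply/funext => u; rewrite /F -mulrA kernE !mulr_sumr; apply: eq_bigr => i _.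
  by rewrite /tc /dphi; ring.
have mF : measurable_fun [set: E * E] F.
  rewrite (_ : F = fun u => dc u *
    (dotv ((u.2 : 'rV[R]_n) - u.1) (phi u.2 - phi u.1) * kern alpha u.1 u.2)).
    exact: measurable_funM.
  by apply/funext => u; rewrite /F mulrA.
have := @Rintegral_weighted_fubini_scaled _ _ _ _ _ lam lam mu _ _ mf mF.
by rewrite EQ => /(_ (integrable_sum_EFin _ ic))[_ <-].
Qed.

Lemma ball_leibniz :
  Rintegral lam (eball x r : set E) (fun y => f y * fdiv lam alpha phi y)
  + Rintegral lam [set: E]
      (fun y => f y * dotv (phi y) (fgrad lam alpha (\1_(eball x r) : _ -> R) y))
  + Rintegral lam [set: E]
      (fun y => f y * fdivNL lam alpha (\1_(eball x r) : _ -> R) phi y)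
  = - \sum_(i < n) charge_integral (mup i) (mun i) (eball x r : set E)
                             (fun y => phi y ord0 i).
Proof.
rewrite ball_term_div ball_term_grad ball_term_NL -!mulrDr -!big_split/= mulr_sumr.
rewrite -sumrN; apply: eq_bigr => i _.
have abE := integrableD measurableT (ia i) (ib i).
have EW : weak alpha lam f i (fun y => c y * phi y ord0 i) = Rintegral P [set: E * E] (ta i)
    + Rintegral P [set: E * E] (tb i) + Rintegral P [set: E * E] (tc i).
  rewrite /weak (_ : dens alpha f i _ = fun u => (ta i u + tb i u) + tc i u).
    by rewrite RintegralD// RintegralD.
  by apply/funext => u; rewrite abcE.
rewrite -EW; have := dcphi i; rewrite /defect => /eqP; rewrite addr_eq0 => /eqP ->.
by rewrite /charge_integral -!Rintegral_indic.
Qed.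

End assembly.

Theorem theorem3p13 (R : realType) (n : nat)
    (lam : {measure set Rn R n -> \bar R}) (Hlam : is_lebesgue_Rn lam)
    (alpha : R) (Halpha : 0 < alpha < 1)
    (p : \bar R) (Hp : (((1 - alpha)^-1)%:E < p)%E)
    (f : 'rV[R]_n -> R) (Hf : BV_ap lam alpha p f)
    (mup mun : 'I_n -> {finite_measure set Rn R n -> \bar R})
    (HD : is_Dalpha lam alpha f mup mun)
    (phi : 'rV[R]_n -> 'rV[R]_n) (Hphi : Lipc phi)
    (x : 'rV[R]_n) :
  {ae (@lebesgue_measure R), forall r : R, 0 < r ->
     Rintegral lam (eball x r : set (Rn R n)) (fun y => f y * fdiv lam alpha phi y)
     + Rintegral lam [set: Rn R n]
         (fun y => f y * dotv (phi y) (fgrad lam alpha (\1_(eball x r) : _ -> R) y))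
     + Rintegral lam [set: Rn R n]
         (fun y => f y * fdivNL lam alpha (\1_(eball x r) : _ -> R) phi y)
     = - \sum_(i < n) charge_integral (mup i) (mun i) (eball x r : set (Rn R n))
                                (fun y => phi y ord0 i)}.
Proof.
have [n0|n_gt0] := posnP n.
  (* In dimension 0 every scalar product is an empty sum and both sides are 0; the kernel estimates
     are for [n >= 1]. *)
  subst n; apply: aeW => r _.
  have d0 (u v : 'rV[R]_0) : dotv u v = 0 by rewrite /dotv big_ord0.
  have fd y : fdiv lam alpha phi y = 0.
    rewrite /fdiv; under eq_Rintegral do rewrite d0 mul0r.
    by rewrite /Rintegral integral0 mulr0.
  have fn y : fdivNL lam alpha (\1_(eball x r) : _ -> R) phi y = 0.
    rewrite /fdivNL; under eq_Rintegral do rewrite d0 mulr0 mul0r.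
    by rewrite /Rintegral integral0 mulr0.
  under eq_Rintegral do rewrite fd mulr0.
  under [X in _ + X + _]eq_Rintegral do rewrite d0 mulr0.
  under [X in _ + _ + X]eq_Rintegral do rewrite fn mulr0.
  by rewrite /Rintegral !integral0 big_ord0 !addr0 oppr0.
have p_gt1 : (1 < p)%E.
  apply: le_lt_trans Hp; rewrite lee_fin; case/andP: Halpha => a0 a1.
  by rewrite invf_ge1 ?subr_gt0// gerBl ltW.
have [lam' El] := ex_sigma_finite_measure (lebesgue_sigma_finite Hlam).
subst lam; case: Hf => mf Lf _.
have [L [K [M [L0 K0 M0 Hc]]]] := lipc_component n_gt0 Hphi.
have H i := @ball_defect R n alpha n_gt0 Halpha lam' Hlam p f p_gt1 mf Lf mup mun HD
  (fun y => phi y ord0 i) L K M L0 K0 M0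
  (let: And3 h _ _ := Hc i in h) (let: And3 _ h _ := Hc i in h)
  (let: And3 _ _ h := Hc i in h) x i.
(* The null sets of the finitely many coordinates are merged into one. *)
have {}H : {ae (@lebesgue_measure R), forall r : R, forall i : 'I_n, 0 < r ->
   (lam' \x lam')%E.-integrable setT
     (EFin \o dens alpha f i (fun y => chi x r y * phi y ord0 i)) /\
   defect alpha lam' f (mup i) (mun i) i (fun y => chi x r y * phi y ord0 i) = 0}.
  by apply: filter_forall => i; exact: H.
have FF := ae_filter_ringOfSetsType (@lebesgue_measure R).
apply: (@filterS _ _ FF _ _ _ H) => r Hr r0.
apply: (@ball_leibniz R n alpha n_gt0 Halpha lam' Hlam p f p_gt1 mf Lf mup mun phi L K M M0).
- by move=> i; case: (Hc i).
- by move=> i; case: (Hc i).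
- by move=> i; case: (Hc i).
- by move=> i; case: (Hr i r0).
- by move=> i; case: (Hr i r0).
Qed.
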